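(* Let $0<\kappa<\infty$, let $\bar C_\kappa\subset\mathbb{R}^2$ be the bounded part of the tropical Hesse curve, and let $V_1=(\kappa,\kappa)$. Equip $\bar C_\kappa$ with the additive group structure, with unit $V_1$, induced from $\mathrm{Pic}^0(\bar C_\kappa)$ by the bijection $\tilde\phi(P)\equiv P-V_1$ (modulo principal divisors). Then the addition of points on $\bar C_\kappa$ is realized via the intersection with tropical lines $r_1$ and $r_2$, as follows. Let $P$ and $Q$ be points on $\bar C_\kappa$. If $P$ and $Q$ are in generic position, then there exists a unique tropical line $r_1$ passing through both $P$ and $Q$; it is the locus of points at which some $h=\max(a,\,b+X,\,c+Y)$ is not smooth. Let $\bar M$ be the third intersection point of $\bar C_\kappa$ and $r_1$. Then $P$, $Q$, $\bar M$ are the zeros of $h$ on $\bar C_\kappa$, so that $(h)=P+Q+\bar M-3V_1$ as divisors on $\bar C_\kappa$, and hence $$P+Q+\bar M=V_1$$ in the group $\bar C_\kappa$. Successively, let $r_2$ be the tropical line passing through both $V_1$ and $\bar M$, and let $M$ be the third intersection point of $\bar C_\kappa$ and $r_2$. Then $\bar M+M=V_1$, and hence $$P+Q=M$$ in the group $\bar C_\kappa$.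
   Context: Tropical Hesse curve. $C_\kappa$ is the tropical curve consisting of the points $(X,Y)$ at which $F(X,Y;\kappa)=\max(3X,3Y,0,\kappa+X+Y)$ is not differentiable. For $0<\kappa<\infty$, $\bar C_\kappa$ denotes $C_\kappa$ with its unbounded edges removed: it is the boundary of the triangle with vertices $V_1=(\kappa,\kappa)$, $V_2=(-\kappa,0)$, $V_3=(0,-\kappa)$. Slopes along an edge are measured with respect to lattice length (a primitive integer direction vector has length $1$). Rational functions and divisors. A rational function on $\bar C_\kappa$ is a continuous function $h$ on $\bar C_\kappa$ whose restriction to each edge is piecewise linear with integer slopes. Its order $\mathrm{ord}_P h$ at $P$ is the sum of the outgoing slopes of $h$ along all segments of $\bar C_\kappa$ emanating from $P$; $P$ is a zero of $h$ if $\mathrm{ord}_P h>0$ and a pole if $\mathrm{ord}_P h<0$. The principal divisor of $h$ is $(h)=\sum_P(\mathrm{ord}_P h)P$. $\mathrm{Pic}^0(\bar C_\kappa)$ is the group of degree-$0$ divisors on $\bar C_\kappa$ modulo principal divisors. The map $\tilde\phi:\bar C_\kappa\to\mathrm{Pic}^0(\bar C_\kappa)$, $\tilde\phi(P)=[P-V_1]$, is a bijection, and addition on $\bar C_\kappa$ is defined by requiring $\tilde\phi(P+Q)=\tilde\phi(P)+\tilde\phi(Q)$; the unit is $V_1$. Tropical lines. Let $\mathbb{T}=\mathbb{R}\cup\{-\infty\}$. A tropical line is the set of points of the plane at which $h(X,Y)=\max(a,\,b+X,\,c+Y)$, with $a,b,c\in\mathbb{T}$, is not smooth. The restrictions of such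 functions $h$ to $\bar C_\kappa$ are exactly the elements of the linear system $R(3V_1)$ of rational functions $h$ on $\bar C_\kappa$ with $(h)+3V_1$ effective. The zeros of $h\in R(3V_1)$ are the intersection points of $\bar C_\kappa$ with the tropical line defined by $h$. *)

(* Defs.v *)
From HB Require Import structures.
From mathcomp Require Import all_boot all_order all_algebra.
From mathcomp Require Import all_classical all_reals all_analysis.

Set Implicit Arguments.
Unset Strict Implicit.
Unset Printing Implicit Defensive.

Import Order.TTheory GRing.Theory Num.Theory.
Import numFieldNormedType.Exports.

Local Open Scope classical_set_scope.
Local Open Scope ring_scope.

Definition plane (R : realType) := (R^o * R^o)%type.

Definition move (R : realType) (p : plane R) (u : int * int) (t : R) : plane R :=
  (p.1 + u.1%:~R * t, p.2 + u.2%:~R * t).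

Definition nonsmooth (R : realType) (h : plane R -> R) : set (plane R) :=
  [set p | ~ differentiable (h : plane R -> R^o) p].

(** ** The tropical Hesse curve *)

Definition hesseF (R : realType) (k : R) (p : plane R) : R :=
  Num.max (3 * p.1) (Num.max (3 * p.2) (Num.max 0 (k + p.1 + p.2))).

Definition hesse_curve (R : realType) (k : R) : set (plane R) :=
  nonsmooth (hesseF k).

Definition V1 (R : realType) (k : R) : plane R := (k, k).
Definition V2 (R : realType) (k : R) : plane R := (- k, 0).
Definition V3 (R : realType) (k : R) : plane R := (0, - k).

(* The three bounded edges V1V2, V2V3, V3V1: initial vertex and primitive
   direction. Each has lattice length k, so it is parametrized by lattice
   length as [move v u t], 0 <= t <= k. The unbounded edges of [hesse_curve k],
   which [Cbar k] leaves out, are the rays from V1, V2, V3 in the directions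
   (1,1), (-1,0), (0,-1). *)
Definition edges (R : realType) (k : R) : seq (plane R * (int * int)) :=
  [:: (V1 k, (-2, -1)); (V2 k, (1, -1)); (V3 k, (1, 2))].

Definition Cbar (R : realType) (k : R) : set (plane R) :=
  [set p | exists e t,
     [/\ e \in edges k, 0 <= t <= k & p = move e.1 e.2 t]].

(** ** Rational functions, orders and divisors *)

Definition piecewise_linear_int (R : realType) (f : R -> R) (l : R) : Prop :=
  exists (n : nat) (s : nat -> R) (m : nat -> int),
    [/\ s 0%N = 0, s n = l,
        (forall i, (i < n)%N -> s i < s i.+1) &
        (forall i t, (i < n)%N -> s i <= t <= s i.+1 ->
           f t = f (s i) + (m i)%:~R * (t - s i))].

(* Only the values of h on [Cbar k] matter. *)
Definition rational_function (R : realType) (k : R) (h : plane R -> R) : Prop :=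
  {within Cbar k, continuous (h : plane R -> R^o)} /\
  forall e, e \in edges k ->
    piecewise_linear_int (fun t => h (move e.1 e.2 t)) k.

(* Outgoing slope of h at p in the primitive direction u, with respect to
   lattice length; it is the only integer with the property below when h is
   affine with integer slope near p in that direction. *)
Definition slope (R : realType) (h : plane R -> R) (p : plane R)
    (u : int * int) : int :=
  xget 0 [set m : int | \forall t \near 0^'+, h (move p u t) = h p + m%:~R * t].

(* Sum of the outgoing slopes of h at p over the segments of C emanating from
   p, where [dirs] lists the possible edge directions with their weights. *)
Definition weighted_order (R : realType) (C : set (plane R))
    (dirs : seq (int * (int * int))) (h : plane R -> R) (p : plane R) : int :=
  \sum_(w <- dirs | `[< \forall t \near 0^'+, C (move p w.2 t) >])
     w.1 * slope h p w.2.

Definition bounded_dirs : seq (int * (int * int)) :=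
  [:: (1, (2, 1)); (1, (-2, -1)); (1, (1, 2)); (1, (-1, -2));
      (1, (1, -1)); (1, (-1, 1))].

(* The unbounded edges have weight 3: along them, two of the monomials 3X, 3Y,
   0 are equal, and their exponents differ by 3 times a primitive vector. *)
Definition unbounded_dirs : seq (int * (int * int)) :=
  [:: (3, (1, 1)); (3, (-1, -1)); (3, (1, 0)); (3, (-1, 0));
      (3, (0, 1)); (3, (0, -1))].

Definition ord (R : realType) (k : R) (h : plane R -> R) (p : plane R) : int :=
  weighted_order (Cbar k) bounded_dirs h p.

(* A divisor on [Cbar k] is represented by its coefficient function on the
   plane, zero outside [Cbar k] ([ord k h p] is an empty sum there). *)
Definition divisor (R : realType) := plane R -> int.

Definition pt (R : realType) (P : plane R) : divisor R :=
  fun p => (p == P)%:Z.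

Definition has_divisor (R : realType) (k : R) (h : plane R -> R)
    (D : divisor R) : Prop :=
  rational_function k h /\ forall p, ord k h p = D p.

Definition lin_equiv (R : realType) (k : R) (D D' : divisor R) : Prop :=
  exists h, has_divisor k h (fun p => D p - D' p).

(* The representative [P] - [V1] of the class of P in Pic^0. Equality in Pic^0
   is [lin_equiv]. *)
Definition phi (R : realType) (k : R) (P : plane R) : divisor R :=
  fun p => pt P p - pt (V1 k) p.

(* The sum is the point S with phi S = phi P + phi Q in Pic^0; it exists and
   is unique for P, Q on [Cbar k] because phi is a bijection onto Pic^0. *)
Definition padd (R : realType) (k : R) (P Q : plane R) : plane R :=
  xget (V1 k)
    [set S | Cbar k S /\ lin_equiv k (phi k S) (fun p => phi k P p + phi k Q p)].

(** ** Tropical lines *)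

(* When the three coefficients are all -oo, [fine] makes the function 0,
   whose nonsmooth locus is empty. *)
Definition trop_linear (R : realType) (h : plane R -> R) : Prop :=
  exists a b c : \bar R,
    [/\ (a < +oo)%E, (b < +oo)%E, (c < +oo)%E &
        forall p, h p =
          fine (maxe a (maxe (b + (p.1 : R)%:E)%E (c + (p.2 : R)%:E)%E))].

Definition tropical_line (R : realType) (r : set (plane R)) : Prop :=
  exists2 h, trop_linear h & r = nonsmooth h.

Definition line_through (R : realType) (P Q : plane R) (r : set (plane R)) :
    Prop :=
  [/\ tropical_line r, r P & r Q].

(* P and Q do not lie on a common translate of a line containing a ray of the
   tropical lines, whose rays have directions (-1,0), (0,-1) and (1,1). *)
Definition generic_position (R : realType) (P Q : plane R) : Prop :=
  [/\ P.1 <> Q.1, P.2 <> Q.2 & P.1 - P.2 <> Q.1 - Q.2].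

(* Intersection multiplicity at p of the weighted tropical curve [hesse_curve k]
   with the tropical line of h (Allermann-Rau; equal to the stable intersection
   multiplicity): the weighted sum of the outgoing slopes of h along all edges
   of the curve, the unbounded ones included. *)
Definition intersection_mult (R : realType) (k : R) (h : plane R -> R)
    (p : plane R) : int :=
  weighted_order (hesse_curve k) (bounded_dirs ++ unbounded_dirs) h p.

(* The intersection points of [Cbar k] and the tropical line r, counted with
   multiplicity, are P, Q, M. *)
Definition third_point (R : realType) (k : R) (r : set (plane R))
    (P Q M : plane R) : Prop :=
  exists h, [/\ trop_linear h, r = nonsmooth h,
    Cbar k `&` r = [set P; Q; M] &
    forall p, Cbar k p -> intersection_mult k h p = pt P p + pt Q p + pt M p].

(* Main.v *)
(* A tropical polynomial fails to be differentiable exactly where its maximum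
   is attained twice, and its outgoing slopes are read off the monomials
   attaining it.  If P and Q on the triangle are in generic position, the
   vertex of the tropical line through them (given by a tropical cross product)
   lies inside the triangle, so each of its three rays crosses the boundary
   once, with multiplicity 1; this gives the third point.  On the boundary,
   multiplicity and order differ only at V1, by the weight 3 of the unbounded
   edge.  The line max(m, X, Y) with m = max(x, y) joins V1 to (x, y), and its
   third point is the reflection (y, x).

   The sum of two points is unique because a function h with divisor S - S' and
   S <> S' cannot exist: the boundary is a cycle of length 3 k, along which h is
   affine between S and S' with integer slopes differing by 1, so periodicity
   would make the length of an arc a multiple of 3 k. *)

Require Import Defs.
From mathcomp Require Import all_boot all_order all_algebra.
From mathcomp Require Import all_classical all_reals all_analysis.
From mathcomp Require Import ring lra zify.

Set Implicit Arguments.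
Unset Strict Implicit.
Unset Printing Implicit Defensive.

Import Order.TTheory GRing.Theory Num.Theory.
Import numFieldNormedType.Exports.

Local Open Scope classical_set_scope.
Local Open Scope ring_scope.

(** [slope] and [padd] choose their value with [xget], so nothing can be computed with them before
    the chosen object is known to exist and to be unique. Orders can be subtracted only once both
    functions are known to have one-sided integer slopes along the edges. An equation
    [padd k P Q = S] needs a function witnessing that S has the right class, and then the
    injectivity of [phi] up to [lin_equiv]. The witnesses are differences of line functions: if h1
    defines r1 and h2 defines r2, then (h2) - (h1) = M + V1 - P - Q, because Mbar and 3 V1 cancel,
    and this is the divisor [phi] M - [phi] P - [phi] Q. Tropical lines may have coefficients -oo.
    Non-smoothness, slopes and orders at p see h only near p and up to an additive constant, so on a
    box around the curve h can be replaced by a maximum of three real affine functions. *)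

Section Differentiability.
Variable R : realType.

(** * Differentiability and touching affine minorants *)

Lemma near_eq_differentiable (V W : normedModType R) (f g : V -> W) (p : V) :
  (\forall q \near p, f q = g q) -> differentiable f p -> differentiable g p.
Proof.
move=> fg df.
have fgp : f p = g p := nbhs_singleton fg.
have [cdf] := (diff_locallyP p f).1 df.
move=> /eqaddoP fo.
have go : g \o shift p = cst (g p) + 'd f p +o_ (0 : V) id.
  apply/eqaddoP => e e0; have := fo e e0.
  have : \forall h \near (0 : V), f (h + p) = g (h + p).
    move: fg; rewrite (near_shift 0) /=.
    by apply: filterS => h /=; rewrite subr0 addrC [p + h]addrC.
  apply: filterS2 => h /= fgh.
  by rewrite !fctE /= -fgp -fgh.
have dg := diff_unique cdf go.
by apply/diff_locallyP; rewrite dg.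
Qed.

Lemma nbhs_box (p : plane R) (e : R) : 0 < e ->
  \forall q \near p, `|q.1 - p.1| < e /\ `|q.2 - p.2| < e.
Proof.
move=> e0; apply/nbhs_ballP; exists e => //= q [h1 h2].
by split; rewrite distrC; [exact: h1|exact: h2].
Qed.

Definition affine_at (g : R * R) (p q : plane R) : R :=
  g.1 * (q.1 - p.1) + g.2 * (q.2 - p.2).

Lemma differentiable_affine (c : R) (g : R * R) (p q : plane R) :
  differentiable ((fun q => c + affine_at g p q) : plane R -> R^o) q.
Proof.
have d1 : differentiable (fst : plane R -> R^o) q.
  apply: (linear_differentiable (f := [the {linear plane R -> R^o} of fst])) => x.
  exact: cvg_fst.
have d2 : differentiable (snd : plane R -> R^o) q.
  apply: (linear_differentiable (f := [the {linear plane R -> R^o} of snd])) => x.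
  exact: cvg_snd.
apply: differentiableD => //.
apply: (@differentiableD _ _ _ (fun q : plane R => g.1 *: (q.1 - p.1) : R^o)
   (fun q : plane R => g.2 *: (q.2 - p.2) : R^o)).
  by apply: differentiableZ; apply: differentiableB.
by apply: differentiableZ; apply: differentiableB.
Qed.

(** Difference quotients with positive step are bounded below by the linear part of the minorant.
    Only an inequality results, but applying it to v and to -v yields equality. *)
Lemma diff_ge_of_minorant (f : plane R -> R) (g : R * R) (p v : plane R) :
  differentiable (f : plane R -> R^o) p ->
  (forall q, f p + affine_at g p q <= f q) ->
  g.1 * v.1 + g.2 * v.2 <= 'd (f : plane R -> R^o) p v.
Proof.
move=> df fg.
have dv := @diff_derivable _ _ _ _ _ v df.
have cv := cvg_dnbhs_at_right dv.
rewrite -deriveE // /derive -(cvg_lim _ cv) //.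
apply: limr_ge; first by apply/cvg_ex; eexists; exact: cv.
near=> h.
have h0 : 0 < h by near: h; exact: nbhs_right_gt.
rewrite /GRing.scale /= ler_pdivlMl //.
have := fg (h *: v + p). rewrite /affine_at /= /GRing.scale /=. lra.
Unshelve. all: by end_near. Qed.

End Differentiability.

(** * Non-smooth loci as tropical zero sets *)

Section Nonsmooth.
Variable R : realType.
Implicit Types (p q P Q : plane R) (k : R).

(** At a point of differentiability, each touching affine minorant has the differential as its
    gradient, as the four directions along the axes show; two distinct gradients are then
    impossible. *)
Lemma nonsmooth_of_minorants (f : plane R -> R) (g g' : R * R) p :
  g <> g' ->
  (forall q, f p + affine_at g p q <= f q) ->
  (forall q, f p + affine_at g' p q <= f q) -> nonsmooth f p.
Proof.
move=> gg' fg fg' df; apply: gg'.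
have E1 (v : plane R) : 'd (f : plane R -> R^o) p (- v) = - 'd (f : plane R -> R^o) p v.
  exact: linearN.
have H (a : R * R) : (forall q, f p + affine_at a p q <= f q) ->
   a = ('d (f : plane R -> R^o) p (1, 0), 'd (f : plane R -> R^o) p (0, 1)).
  move=> h.
  have h1 := @diff_ge_of_minorant _ f a p (1, 0) df h.
  have h2 := @diff_ge_of_minorant _ f a p (- (1, 0)) df h.
  have h3 := @diff_ge_of_minorant _ f a p (0, 1) df h.
  have h4 := @diff_ge_of_minorant _ f a p (- (0, 1)) df h.
  move: h1 h2 h3 h4; rewrite !E1 /=.
  set x := ('d _ _ _); set y := ('d _ _ _); case: a h => a1 a2 /= _ h1 h2 h3 h4.
  congr pair; apply/eqP; rewrite eq_le; apply/andP; split; lra.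
by rewrite (H _ fg) (H _ fg').
Qed.

Lemma smooth_of_near_affine (f : plane R -> R) (c : R) (g : R * R) p :
  (\forall q \near p, c + affine_at g p q = f q) -> ~ nonsmooth f p.
Proof.
by move=> /near_eq_differentiable fE; apply; apply: fE; exact: differentiable_affine.
Qed.

Lemma near_affine_lt (c c' : R) (g g' : R * R) p : c < c' ->
  \forall q \near p, c + affine_at g p q < c' + affine_at g' p q.
Proof.
move=> cc.
have ct : {for p, continuous (fun q : plane R => (c' - c) + affine_at (g' - g) p q : R^o)}.
  exact: differentiable_continuous (differentiable_affine _ _ _ _).
have : 0 < (c' - c) + affine_at (g' - g) p p by rewrite /affine_at; lra.
move/(cvgr_gt _ ct); apply: filterS => q; rewrite /affine_at /=; lra.
Qed.

Definition tl (a b c : R) (p : plane R) : R :=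
  Num.max a (Num.max (b + p.1) (c + p.2)).

Lemma tlP a b c p : [/\ a <= tl a b c p, b + p.1 <= tl a b c p, c + p.2 <= tl a b c p &
  [\/ tl a b c p = a, tl a b c p = b + p.1 | tl a b c p = c + p.2]].
Proof.
rewrite /tl; split; rewrite ?le_max ?lexx ?orbT //.
case: (leP a) => _; last by constructor 1.
by case: (leP (b + p.1)) => _; [constructor 3|constructor 2].
Qed.

Definition twice3 (x y z : R) :=
  [\/ x = y /\ z <= x, x = z /\ y <= x | y = z /\ x <= y].

(** Two monomials attaining the maximum are two touching minorants with different gradients. If only
    one attains it, the strict inequalities persist nearby and the function is affine there. *)
Lemma nonsmooth_tl a b c p : nonsmooth (tl a b c) p <-> twice3 a (b + p.1) (c + p.2).
Proof.
have [h1 h2 h3 h4] := tlP a b c p.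
split; last first.
  have g12 : (1, 0) <> (0, 1) :> R * R by case => /eqP; rewrite oner_eq0.
  have g01 : (0, 0) <> (1, 0) :> R * R by case => /esym/eqP; rewrite oner_eq0.
  have g02 : (0, 0) <> (0, 1) :> R * R by case => /esym/eqP; rewrite oner_eq0.
  case=> -[e1 e2]; [apply: (nonsmooth_of_minorants g01) | apply: (nonsmooth_of_minorants g02)
     | apply: (nonsmooth_of_minorants g12)] => q; have [k1 k2 k3 _] := tlP a b c q;
  rewrite /affine_at /=; case: h4 => h4; lra.
apply: contraPP => h.
have [[i1 i2]|[[i1 i2]|[i1 i2]]] :
  (b + p.1 < a /\ c + p.2 < a) \/ (a < b + p.1 /\ c + p.2 < b + p.1) \/
  (a < c + p.2 /\ b + p.1 < c + p.2).
- have Hlt (x y : R) : x <= y -> (x = y -> twice3 a (b + p.1) (c + p.2)) -> x < y.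
    by move=> xy e; rewrite lt_neqAle xy andbT; apply/eqP => /e.
  case: h4 => h4; [left|right; left|right; right]; split; apply: Hlt => [|e]; try lra;
  solve [constructor 1; lra | constructor 2; lra | constructor 3; lra].
- apply: (@smooth_of_near_affine _ (a) (0, 0)).
  have := @near_affine_lt (b + p.1) (a) (1, 0) (0, 0) p i1.
  have := @near_affine_lt (c + p.2) (a) (0, 1) (0, 0) p i2.
  apply: filterS2 => q; rewrite /affine_at /=.
  by have [k1 k2 k3 []E] := tlP a b c q; move: k1 k2 k3; rewrite E; clear; lra.
- apply: (@smooth_of_near_affine _ (b + p.1) (1, 0)).
  have := @near_affine_lt (a) (b + p.1) (0, 0) (1, 0) p i1.
  have := @near_affine_lt (c + p.2) (b + p.1) (0, 1) (1, 0) p i2.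
  apply: filterS2 => q; rewrite /affine_at /=.
  by have [k1 k2 k3 []E] := tlP a b c q; move: k1 k2 k3; rewrite E; clear; lra.
- apply: (@smooth_of_near_affine _ (c + p.2) (0, 1)).
  have := @near_affine_lt (a) (c + p.2) (0, 0) (0, 1) p i1.
  have := @near_affine_lt (b + p.1) (c + p.2) (1, 0) (0, 1) p i2.
  apply: filterS2 => q; rewrite /affine_at /=.
  by have [k1 k2 k3 []E] := tlP a b c q; move: k1 k2 k3; rewrite E; clear; lra.
Qed.

Lemma hesseFP k p : [/\ 3 * p.1 <= hesseF k p, 3 * p.2 <= hesseF k p, 0 <= hesseF k p,
   k + p.1 + p.2 <= hesseF k p &
  [\/ hesseF k p = 3 * p.1, hesseF k p = 3 * p.2, hesseF k p = 0 | hesseF k p = k + p.1 + p.2]].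
Proof.
rewrite /hesseF; split; rewrite ?le_max ?lexx ?orbT //.
case: (leP (3 * p.1)) => _; last by constructor 1.
case: (leP (3 * p.2)) => _; last by constructor 2.
by case: (leP 0 (k + p.1 + p.2)) => _; [constructor 4|constructor 3].
Qed.

Definition twice4 (x y z w : R) :=
  [\/ x = w /\ (y <= w /\ z <= w), y = w /\ (x <= w /\ z <= w), z = w /\ (x <= w /\ y <= w) |
   [\/ x = y /\ (z <= x /\ w <= x), x = z /\ (y <= x /\ w <= x) | y = z /\ (x <= y /\ w <= y)]].

Lemma twice4_of_hesse k p : twice4 (3 * p.1) (3 * p.2) 0 (k + p.1 + p.2) -> hesse_curve k p.
Proof.
have [h1 h2 h3 h4 h5] := hesseFP k p.
have H (g g' : R * R) : g.1 <> g'.1 \/ g.2 <> g'.2 ->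
  (forall q, hesseF k p + affine_at g p q <= hesseF k q) ->
  (forall q, hesseF k p + affine_at g' p q <= hesseF k q) -> hesse_curve k p.
  by move=> gg; apply: nonsmooth_of_minorants => e; rewrite e in gg; case: gg.
(* A monomial attaining the maximum at p is a touching minorant, with its exponent vector as
   gradient. *)
have M1 : hesseF k p = 3 * p.1 ->
    forall q, hesseF k p + affine_at (3, 0) p q <= hesseF k q.
  by move=> e q; have [k1 k2 k3 k4 _] := hesseFP k q; rewrite /affine_at /=; lra.
have M2 : hesseF k p = 3 * p.2 ->
    forall q, hesseF k p + affine_at (0, 3) p q <= hesseF k q.
  by move=> e q; have [k1 k2 k3 k4 _] := hesseFP k q; rewrite /affine_at /=; lra.
have M0 : hesseF k p = 0 ->
    forall q, hesseF k p + affine_at (0, 0) p q <= hesseF k q.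
  by move=> e q; have [k1 k2 k3 k4 _] := hesseFP k q; rewrite /affine_at /=; lra.
have M3 : hesseF k p = k + p.1 + p.2 ->
    forall q, hesseF k p + affine_at (1, 1) p q <= hesseF k q.
  by move=> e q; have [k1 k2 k3 k4 _] := hesseFP k q; rewrite /affine_at /=; lra.
have n10 : (1 : R) <> 0 by apply/eqP; rewrite oner_eq0.
have n30 : (3 : R) <> 0 by apply/eqP; rewrite pnatr_eq0.
have n31 : (3 : R) <> 1 by lra.
have n13 : (0 : R) <> 3 by move/esym.
have n01 : (0 : R) <> 1 by move/esym.
case=> [[e1 [e2 e3]]|[e1 [e2 e3]]|[e1 [e2 e3]]|].
- by apply: (H (3, 0) (1, 1)); [by left | apply: M1 | apply: M3];
  case: h5 h1 h2 h3 h4 => ->; move: e1 e2 e3; clear; lra.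
- by apply: (H (0, 3) (1, 1)); [by left | apply: M2 | apply: M3];
  case: h5 h1 h2 h3 h4 => ->; move: e1 e2 e3; clear; lra.
- by apply: (H (0, 0) (1, 1)); [by left | apply: M0 | apply: M3];
  case: h5 h1 h2 h3 h4 => ->; move: e1 e2 e3; clear; lra.
case=> -[e1 [e2 e3]].
- by apply: (H (3, 0) (0, 3)); [by left | apply: M1 | apply: M2];
  case: h5 h1 h2 h3 h4 => ->; move: e1 e2 e3; clear; lra.
- by apply: (H (3, 0) (0, 0)); [by left | apply: M1 | apply: M0];
  case: h5 h1 h2 h3 h4 => ->; move: e1 e2 e3; clear; lra.
- by apply: (H (0, 3) (0, 0)); [by right | apply: M2 | apply: M0];
  case: h5 h1 h2 h3 h4 => ->; move: e1 e2 e3; clear; lra.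
Qed.

Lemma hesse_smooth k p :
  ~ twice4 (3 * p.1) (3 * p.2) 0 (k + p.1 + p.2) -> ~ hesse_curve k p.
Proof.
move=> h.
have [[i1 [i2 i3]]|[[i1 [i2 i3]]|[[i1 [i2 i3]]|[i1 [i2 i3]]]]] :
    (3 * p.2 < 3 * p.1 /\ 0 < 3 * p.1 /\ k + p.1 + p.2 < 3 * p.1) \/
    (3 * p.1 < 3 * p.2 /\ 0 < 3 * p.2 /\ k + p.1 + p.2 < 3 * p.2) \/
    (3 * p.1 < 0 /\ 3 * p.2 < 0 /\ k + p.1 + p.2 < 0) \/
    (3 * p.1 < k + p.1 + p.2 /\ 3 * p.2 < k + p.1 + p.2 /\ 0 < k + p.1 + p.2).
- have Hlt (x y : R) : x <= y ->
      (x = y -> twice4 (3 * p.1) (3 * p.2) 0 (k + p.1 + p.2)) -> x < y.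
    by move=> xy e; rewrite lt_neqAle xy andbT; apply/eqP => /e.
  have [h1 h2 h3 h4 h5] := hesseFP k p.
  case: h5 => h5; rewrite h5 in h1 h2 h3 h4; clear h5 h;
  [left|right; left|right; right; left|right; right; right];
  (split; [|split]); apply: Hlt => // e;
    solve [constructor 1; lra | constructor 2; lra | constructor 3; lra |
      constructor 4; solve [constructor 1; lra | constructor 2; lra | constructor 3; lra]].
- apply: (@smooth_of_near_affine _ (3 * p.1) (3, 0)).
  have := @near_affine_lt (3 * p.2) (3 * p.1) (0, 3) (3, 0) p i1.
  have := @near_affine_lt (0) (3 * p.1) (0, 0) (3, 0) p i2.
  have := @near_affine_lt (k + p.1 + p.2) (3 * p.1) (1, 1) (3, 0) p i3.
  apply: filterS3 => q; rewrite /affine_at /=.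
  by have [k1 k2 k3 k4 []E] := hesseFP k q; move: k1 k2 k3 k4; rewrite E; clear; lra.
- apply: (@smooth_of_near_affine _ (3 * p.2) (0, 3)).
  have := @near_affine_lt (3 * p.1) (3 * p.2) (3, 0) (0, 3) p i1.
  have := @near_affine_lt (0) (3 * p.2) (0, 0) (0, 3) p i2.
  have := @near_affine_lt (k + p.1 + p.2) (3 * p.2) (1, 1) (0, 3) p i3.
  apply: filterS3 => q; rewrite /affine_at /=.
  by have [k1 k2 k3 k4 []E] := hesseFP k q; move: k1 k2 k3 k4; rewrite E; clear; lra.
- apply: (@smooth_of_near_affine _ (0) (0, 0)).
  have := @near_affine_lt (3 * p.1) (0) (3, 0) (0, 0) p i1.
  have := @near_affine_lt (3 * p.2) (0) (0, 3) (0, 0) p i2.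
  have := @near_affine_lt (k + p.1 + p.2) (0) (1, 1) (0, 0) p i3.
  apply: filterS3 => q; rewrite /affine_at /=.
  by have [k1 k2 k3 k4 []E] := hesseFP k q; move: k1 k2 k3 k4; rewrite E; clear; lra.
- apply: (@smooth_of_near_affine _ (k + p.1 + p.2) (1, 1)).
  have := @near_affine_lt (3 * p.1) (k + p.1 + p.2) (3, 0) (1, 1) p i1.
  have := @near_affine_lt (3 * p.2) (k + p.1 + p.2) (0, 3) (1, 1) p i2.
  have := @near_affine_lt (0) (k + p.1 + p.2) (0, 0) (1, 1) p i3.
  apply: filterS3 => q; rewrite /affine_at /=.
  by have [k1 k2 k3 k4 []E] := hesseFP k q; move: k1 k2 k3 k4; rewrite E; clear; lra.
Qed.

End Nonsmooth.

(** * The curve in coordinates, and directions staying on it *)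

Section LocalStructure.
Variable R : realType.
Implicit Types (p q P Q : plane R) (k : R) (C : set (plane R)) (h : plane R -> R)
  (u : int * int) (dirs : seq (int * (int * int))).

Definition triangle_eqns (k x y : R) : Prop :=
  (x - 2 * y = - k /\ 0 <= y /\ y <= k) \/
  (x + y = - k /\ - k <= y /\ y <= 0) \/
  (y - 2 * x = - k /\ 0 <= x /\ x <= k).

Lemma CbarP k p : Cbar k p <-> triangle_eqns k p.1 p.2.
Proof.
split.
- move=> [e [t [+ /andP[t0 tk] ->]]].
  rewrite /edges !inE => /or3P[] /eqP -> /=; rewrite /triangle_eqns /V1 /V2 /V3 /=.
  + by left; lra.
  + by right; left; lra.
  + by right; right; lra.
- case: p => x y /= [[e [h1 h2]]|[[e [h1 h2]]|[e [h1 h2]]]].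
  + exists (V1 k, (-2, -1)), (k - y); split; first by rewrite /edges !inE eqxx.
      by apply/andP; split; lra.
    by rewrite /move /V1 /=; congr pair; lra.
  + exists (V2 k, (1, -1)), (- y); split; first by rewrite /edges !inE eqxx orbT.
      by apply/andP; split; lra.
    by rewrite /move /V2 /=; congr pair; lra.
  + exists (V3 k, (1, 2)), x; split; first by rewrite /edges !inE eqxx !orbT.
      by apply/andP; split; lra.
    by rewrite /move /V3 /=; congr pair; lra.
Qed.

(** One disjunct for each pair of monomials of [hesseF]: the first three are the bounded edges V3V1,
    V1V2, V2V3, the last three the rays from V1, V3, V2. *)
Definition hesse_eqns (k x y : R) : Prop :=
  (3 * x = k + x + y /\ 3 * y <= k + x + y /\ 0 <= k + x + y) \/
  (3 * y = k + x + y /\ 3 * x <= k + x + y /\ 0 <= k + x + y) \/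
  (0 = k + x + y /\ 3 * x <= k + x + y /\ 3 * y <= k + x + y) \/
  (3 * x = 3 * y /\ 0 <= 3 * x /\ k + x + y <= 3 * x) \/
  (3 * x = 0 /\ 3 * y <= 3 * x /\ k + x + y <= 3 * x) \/
  (3 * y = 0 /\ 3 * x <= 3 * y /\ k + x + y <= 3 * y).

Lemma hesse_curveP k p : hesse_curve k p <-> hesse_eqns k p.1 p.2.
Proof.
have E : hesse_eqns k p.1 p.2 <-> twice4 (3 * p.1) (3 * p.2) 0 (k + p.1 + p.2).
  rewrite /hesse_eqns /twice4; split.
    case=> [h|[h|[h|[h|[h|h]]]]]; [exact: Or41|exact: Or42|exact: Or43|..]; apply: Or44;
    [exact: Or31|exact: Or32|exact: Or33].
  case=> [h|h|h|[h|h|h]]; tauto.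
rewrite E; split; last exact: twice4_of_hesse.
by apply: contraPP; exact: hesse_smooth.
Qed.

Definition near_dir (C : set (plane R)) p (u : int * int) : Prop :=
  exists2 d : R, 0 < d & forall t, 0 < t -> t < d -> C (move p u t).

Lemma near_right0 (A : set R) :
  (\forall t \near 0^'+, A t) <-> exists2 d : R, 0 < d & forall t, 0 < t -> t < d -> A t.
Proof.
split.
  move=> [d /= d0 h]; exists d => // t t0 td; apply: h => //=.
  by rewrite sub0r normrN gtr0_norm.
move=> [d d0 h]; near=> t; apply: h; near: t; first exact: nbhs_right_gt.
exact: nbhs_right_lt.
Unshelve. all: by end_near. Qed.

Lemma weighted_order_nil C h p : weighted_order C [::] h p = 0.
Proof. exact: big_nil. Qed.

Lemma weighted_order_cons_true C w u dirs h p : near_dir C p u ->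
  weighted_order C ((w, u) :: dirs) h p = w * slope h p u + weighted_order C dirs h p.
Proof.
by move=> H; rewrite /weighted_order big_cons ifT //; apply/asboolP/near_right0.
Qed.

Lemma weighted_order_cons_false C w u dirs h p : near_dir (~` C) p u ->
  weighted_order C ((w, u) :: dirs) h p = weighted_order C dirs h p.
Proof.
move=> [d d0 H]; rewrite /weighted_order big_cons ifF //.
apply/asboolPn => /near_right0 [e e0 H'].
have m0 : 0 < Num.min d e by rewrite lt_min d0.
have := H (Num.min d e / 2); have := H' (Num.min d e / 2).
have : Num.min d e <= d by rewrite ge_min lexx.
have : Num.min d e <= e by rewrite ge_min lexx orbT.
set m := Num.min d e in m0 * => me md h1 h2.
by apply: h2; [| |apply: h1]; lra.
Qed.

(** The factor 10 is slack: coordinates move at speed at most 2, so a move shorter than d stays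
    clear of the far ends of the edges. *)
Lemma small_step (a b : R) : 0 < a -> 0 < b -> exists2 d : R, 0 < d & 10 * d < a /\ 10 * d < b.
Proof.
move=> a0 b0; exists (Num.min a b / 20).
  by rewrite divr_gt0 // lt_min a0.
have : Num.min a b <= b by rewrite ge_min lexx orbT.
have : Num.min a b <= a by rewrite ge_min lexx.
have : 0 < Num.min a b by rewrite lt_min a0.
by move: (Num.min a b) => m; lra.
Qed.

End LocalStructure.

Ltac dir_tac d :=
  exists d => // t t0 td;
  first [ apply/CbarP | apply/hesse_curveP | move/CbarP | move/hesse_curveP ];
  rewrite /triangle_eqns /hesse_eqns /move /V1 /V2 /V3 /=; lra.

(** [dT] keeps the head of the direction list because the curve continues that way, [dF] drops it
    because the direction leaves the curve at once. A run of them follows the order of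
    [bounded_dirs], then [unbounded_dirs]. *)
Ltac dT d := rewrite weighted_order_cons_true; [|by dir_tac d].
Ltac dF d := rewrite weighted_order_cons_false; [|by dir_tac d].

(** * Orders and multiplicities at each vertex and on each open edge *)

Section Orders.
Variable R : realType.
Implicit Types (p q P Q : plane R) (k : R) (h : plane R -> R).

Lemma ord_V1 k h : 0 < k ->
  ord k h (V1 k) = slope h (V1 k) (-2, -1) + slope h (V1 k) (-1, -2).
Proof.
move=> k0; have [d d0 [d1 d2]] := small_step k0 k0.
rewrite /ord /bounded_dirs.
dF d; dT d; dF d; dT d; dF d; dF d.
by rewrite weighted_order_nil !mul1r addr0 ?addrA.
Qed.

Lemma mult_V1 k h : 0 < k ->
  intersection_mult k h (V1 k) =
    slope h (V1 k) (-2, -1) + slope h (V1 k) (-1, -2) + 3 * slope h (V1 k) (1, 1).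
Proof.
move=> k0; have [d d0 [d1 d2]] := small_step k0 k0.
rewrite /intersection_mult /bounded_dirs /unbounded_dirs /cat.
dF d; dT d; dF d; dT d; dF d; dF d; dT d; dF d; dF d; dF d; dF d; dF d.
by rewrite weighted_order_nil !mul1r addr0 ?addrA.
Qed.

Lemma ord_V2 k h : 0 < k ->
  ord k h (V2 k) = slope h (V2 k) (2, 1) + slope h (V2 k) (1, -1).
Proof.
move=> k0; have [d d0 [d1 d2]] := small_step k0 k0.
rewrite /ord /bounded_dirs.
dT d; dF d; dF d; dF d; dT d; dF d.
by rewrite weighted_order_nil !mul1r addr0 ?addrA.
Qed.

Lemma mult_V2 k h : 0 < k ->
  intersection_mult k h (V2 k) =
    slope h (V2 k) (2, 1) + slope h (V2 k) (1, -1) + 3 * slope h (V2 k) (-1, 0).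
Proof.
move=> k0; have [d d0 [d1 d2]] := small_step k0 k0.
rewrite /intersection_mult /bounded_dirs /unbounded_dirs /cat.
dT d; dF d; dF d; dF d; dT d; dF d; dF d; dF d; dF d; dT d; dF d; dF d.
by rewrite weighted_order_nil !mul1r addr0 ?addrA.
Qed.

Lemma ord_V3 k h : 0 < k ->
  ord k h (V3 k) = slope h (V3 k) (1, 2) + slope h (V3 k) (-1, 1).
Proof.
move=> k0; have [d d0 [d1 d2]] := small_step k0 k0.
rewrite /ord /bounded_dirs.
dF d; dF d; dT d; dF d; dF d; dT d.
by rewrite weighted_order_nil !mul1r addr0 ?addrA.
Qed.

Lemma mult_V3 k h : 0 < k ->
  intersection_mult k h (V3 k) =
    slope h (V3 k) (1, 2) + slope h (V3 k) (-1, 1) + 3 * slope h (V3 k) (0, -1).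
Proof.
move=> k0; have [d d0 [d1 d2]] := small_step k0 k0.
rewrite /intersection_mult /bounded_dirs /unbounded_dirs /cat.
dF d; dF d; dT d; dF d; dF d; dT d; dF d; dF d; dF d; dF d; dF d; dT d.
by rewrite weighted_order_nil !mul1r addr0 ?addrA.
Qed.

Lemma ord_E12 k h p : 0 < k -> p.1 - 2 * p.2 = - k -> 0 < p.2 -> p.2 < k ->
  ord k h p = slope h p (2, 1) + slope h p (-2, -1).
Proof.
move=> k0 e h1 h2; have h3 : 0 < k - p.2 by lra.
have [d d0 [d1 d2]] := small_step h1 h3.
clear h1 h2 h3; case: p e d1 d2 => x y /= e d1 d2.
rewrite /ord /bounded_dirs.
dT d; dT d; dF d; dF d; dF d; dF d.
by rewrite weighted_order_nil !mul1r addr0 ?addrA.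
Qed.

Lemma mult_E12 k h p : 0 < k -> p.1 - 2 * p.2 = - k -> 0 < p.2 -> p.2 < k ->
  intersection_mult k h p = slope h p (2, 1) + slope h p (-2, -1).
Proof.
move=> k0 e h1 h2; have h3 : 0 < k - p.2 by lra.
have [d d0 [d1 d2]] := small_step h1 h3.
clear h1 h2 h3; case: p e d1 d2 => x y /= e d1 d2.
rewrite /intersection_mult /bounded_dirs /unbounded_dirs /cat.
dT d; dT d; dF d; dF d; dF d; dF d; dF d; dF d; dF d; dF d; dF d; dF d.
by rewrite weighted_order_nil !mul1r addr0 ?addrA.
Qed.

Lemma ord_E23 k h p : 0 < k -> p.1 + p.2 = - k -> - k < p.2 -> p.2 < 0 ->
  ord k h p = slope h p (1, -1) + slope h p (-1, 1).
Proof.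
move=> k0 e h1 h2; have h3 : 0 < - p.2 by lra.
have h4 : 0 < p.2 + k by lra.
have [d d0 [d1 d2]] := small_step h3 h4.
clear h1 h2 h3 h4; case: p e d1 d2 => x y /= e d1 d2.
rewrite /ord /bounded_dirs.
dF d; dF d; dF d; dF d; dT d; dT d.
by rewrite weighted_order_nil !mul1r addr0 ?addrA.
Qed.

Lemma mult_E23 k h p : 0 < k -> p.1 + p.2 = - k -> - k < p.2 -> p.2 < 0 ->
  intersection_mult k h p = slope h p (1, -1) + slope h p (-1, 1).
Proof.
move=> k0 e h1 h2; have h3 : 0 < - p.2 by lra.
have h4 : 0 < p.2 + k by lra.
have [d d0 [d1 d2]] := small_step h3 h4.
clear h1 h2 h3 h4; case: p e d1 d2 => x y /= e d1 d2.
rewrite /intersection_mult /bounded_dirs /unbounded_dirs /cat.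
dF d; dF d; dF d; dF d; dT d; dT d; dF d; dF d; dF d; dF d; dF d; dF d.
by rewrite weighted_order_nil !mul1r addr0 ?addrA.
Qed.

Lemma ord_E31 k h p : 0 < k -> p.2 - 2 * p.1 = - k -> 0 < p.1 -> p.1 < k ->
  ord k h p = slope h p (1, 2) + slope h p (-1, -2).
Proof.
move=> k0 e h1 h2; have h3 : 0 < k - p.1 by lra.
have [d d0 [d1 d2]] := small_step h1 h3.
clear h1 h2 h3; case: p e d1 d2 => x y /= e d1 d2.
rewrite /ord /bounded_dirs.
dF d; dF d; dT d; dT d; dF d; dF d.
by rewrite weighted_order_nil !mul1r addr0 ?addrA.
Qed.

Lemma mult_E31 k h p : 0 < k -> p.2 - 2 * p.1 = - k -> 0 < p.1 -> p.1 < k ->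
  intersection_mult k h p = slope h p (1, 2) + slope h p (-1, -2).
Proof.
move=> k0 e h1 h2; have h3 : 0 < k - p.1 by lra.
have [d d0 [d1 d2]] := small_step h1 h3.
clear h1 h2 h3; case: p e d1 d2 => x y /= e d1 d2.
rewrite /intersection_mult /bounded_dirs /unbounded_dirs /cat.
dF d; dF d; dT d; dT d; dF d; dF d; dF d; dF d; dF d; dF d; dF d; dF d.
by rewrite weighted_order_nil !mul1r addr0 ?addrA.
Qed.

End Orders.

(** * Outgoing slopes and their locality *)

Section Slopes.
Variable R : realType.
Implicit Types (p q P Q : plane R) (k : R) (f g h : plane R -> R) (u : int * int).

Definition slope_at h p u (m : int) : Prop :=
  exists2 d : R, 0 < d &
    forall t, 0 < t -> t < d -> h (move p u t) = h p + m%:~R * t.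

Lemma slope_at_inj h p u (m n : int) : slope_at h p u m -> slope_at h p u n -> m = n.
Proof.
move=> [d d0 hd] [e e0 he].
have [t t0 [td te]] := small_step d0 e0.
have := he t t0; rewrite hd //; last by lra.
move=> H; have {}H : (m%:~R : R) * t = n%:~R * t by apply: (addrI (h p)); apply: H; lra.
by apply/eqP; rewrite -(eqr_int R); apply/eqP; apply: (mulIf _ H); rewrite gt_eqF.
Qed.

Lemma slopeE h p u m : slope_at h p u m -> slope h p u = m.
Proof.
move=> hm; rewrite /slope; case: xgetP => [n _ hn|hn].
  by apply: slope_at_inj hm; apply/near_right0.
by case: (hn m); apply/near_right0.
Qed.

Lemma slope_at_sub f g p u m n : slope_at f p u m -> slope_at g p u n ->
  slope_at (fun q => f q - g q) p u (m - n).
Proof.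
move=> [d d0 hd] [e e0 he]; exists (Num.min d e); first by rewrite lt_min d0.
move=> t t0; rewrite lt_min => /andP[td te].
rewrite hd // he // rmorphB /=; ring.
Qed.

Lemma near_right0_mul_lt (x e : R) : 0 < e -> exists2 d : R, 0 < d &
  forall t, 0 < t -> t < d -> x * t < e.
Proof.
move=> e0; exists (e / (`|x| + 1)).
  by rewrite divr_gt0 // ltr_wpDl // normr_ge0.
move=> t t0; rewrite ltr_pdivlMr ?ltr_wpDl // mulrDr mulr1 => h.
apply: le_lt_trans (_ : t * `|x| < e); last by lra.
by rewrite mulrC ler_wpM2l // ?ler_norm // ltW.
Qed.

Lemma slope_at_local f g p u (c e : R) m : 0 < e ->
  (forall q, `|q.1 - p.1| < e -> `|q.2 - p.2| < e -> f q = g q + c) ->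
  slope_at g p u m -> slope_at f p u m.
Proof.
move=> e0 fg [d d0 hd].
have [d1 d10 h1] := near_right0_mul_lt `|u.1%:~R| e0.
have [d2 d20 h2] := near_right0_mul_lt `|u.2%:~R| e0.
exists (Num.min d (Num.min d1 d2)); first by rewrite !lt_min d0 d10.
move=> t t0; rewrite !lt_min => /and3P[td td1 td2].
rewrite fg; [|rewrite /move /= [_ + _ * _]addrC addrK normrM (gtr0_norm t0); exact: h1
             |rewrite /move /= [_ + _ * _]addrC addrK normrM (gtr0_norm t0); exact: h2].
by rewrite hd // fg ?subrr ?normr0 // addrAC.
Qed.

(** No existence of a slope is assumed: f and g admit the same integers, so [xget] chooses from the
    same set. *)
Lemma slope_local f g p u (c e : R) : 0 < e ->
  (forall q, `|q.1 - p.1| < e -> `|q.2 - p.2| < e -> f q = g q + c) ->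
  slope f p u = slope g p u.
Proof.
move=> e0 fg; rewrite /slope; congr (xget _ _); apply/seteqP; split => m /=.
  move=> /near_right0 h; apply/near_right0; apply: (@slope_at_local g f p u (- c) e) => //.
  by move=> q h1 h2; rewrite fg // addrK.
by move=> /near_right0 h; apply/near_right0; apply: (@slope_at_local f g p u c e).
Qed.

(* For pairs (value, slope): the slope of a maximum is computed by the
   lexicographic maximum. *)
Definition lexmax (x y : R * int) : R * int :=
  if x.1 < y.1 then y else if y.1 < x.1 then x else (x.1, Num.max x.2 y.2).

Lemma lexmax1 x y : (lexmax x y).1 = Num.max x.1 y.1.
Proof. by rewrite /lexmax; case: ltgtP. Qed.

(** If the values at p differ, the larger function stays larger for small t; if they agree, the
    larger slope wins for every t > 0. *)
Lemma slope_at_max f g p u m n : slope_at f p u m -> slope_at g p u n ->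
  slope_at (fun q => Num.max (f q) (g q)) p u (lexmax (f p, m) (g p, n)).2.
Proof.
move=> [d d0 hd] [e e0 he]; rewrite /slope_at /lexmax /=.
have [fg|gf|E] := ltgtP (f p) (g p).
- have fg0 : 0 < g p - f p by rewrite subr_gt0.
  have [d1 d10 h1] := near_right0_mul_lt (m%:~R - n%:~R) fg0.
  exists (Num.min d (Num.min e d1)); first by rewrite !lt_min d0 e0.
  move=> t t0; rewrite !lt_min => /and3P[td te td1].
  rewrite hd // he //; apply: max_r; have := h1 t t0 td1; lra.
- have fg0 : 0 < f p - g p by rewrite subr_gt0.
  have [d1 d10 h1] := near_right0_mul_lt (n%:~R - m%:~R) fg0.
  exists (Num.min d (Num.min e d1)); first by rewrite !lt_min d0 e0.
  move=> t t0; rewrite !lt_min => /and3P[td te td1].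
  rewrite hd // he //; apply: max_l; have := h1 t t0 td1; lra.
- exists (Num.min d e); first by rewrite lt_min d0.
  move=> t t0; rewrite lt_min => /andP[td te].
  rewrite hd // he // E -addr_maxr; congr (_ + _).
  by rewrite -maxr_pMl ?ltW //; congr (_ * _); case: (leP m n) => mn;
    [rewrite max_r // ler_int|rewrite max_l // ler_int ltW].
Qed.

Definition slope3 (x y z : R) u : int :=
  (lexmax (x, 0) (lexmax (y, u.1) (z, u.2))).2.

Lemma slope_at_tl a b c p u : slope_at (tl a b c) p u (slope3 a (b + p.1) (c + p.2) u).
Proof.
have h0 : slope_at (fun=> a) p u 0.
  by exists 1 => // t _ _; rewrite mul0r addr0.
have h1 : slope_at (fun q => b + q.1) p u u.1.
  by exists 1 => // t _ _; rewrite addrA.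
have h2 : slope_at (fun q => c + q.2) p u u.2.
  by exists 1 => // t _ _; rewrite addrA.
have h3 := slope_at_max h1 h2.
have := slope_at_max h0 h3; rewrite /slope3.
have -> : Num.max (b + p.1) (c + p.2) = (lexmax (b + p.1, u.1) (c + p.2, u.2)).1 by rewrite lexmax1.
by rewrite -surjective_pairing.
Qed.

Lemma slope_tl a b c p u : slope (tl a b c) p u = slope3 a (b + p.1) (c + p.2) u.
Proof. exact/slopeE/slope_at_tl. Qed.

End Slopes.

(** * Rays of a tropical line against the triangle *)

Section Triangle.
Variable R : realType.
Implicit Types (p q P Q : plane R) (k a b c : R).

Variant Cbar_spec k p : Prop :=
| AtV1 of p = V1 k
| AtV2 of p = V2 k
| AtV3 of p = V3 k
| OnE12 of p.1 - 2 * p.2 = - k & 0 < p.2 & p.2 < k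
| OnE23 of p.1 + p.2 = - k & - k < p.2 & p.2 < 0
| OnE31 of p.2 - 2 * p.1 = - k & 0 < p.1 & p.1 < k.

Lemma Cbar_cases k p : Cbar k p -> Cbar_spec k p.
Proof.
rewrite CbarP; case: p => x y; rewrite /triangle_eqns /=.
have E (x' y' : R) : x = x' -> y = y' -> (x, y) = (x', y') by move=> -> ->.
case=> [[e [h1 h2]]|[[e [h1 h2]]|[e [h1 h2]]]].
- case: (ltgtP 0 y) h1 => // h1 _; last by apply/AtV2/E; lra.
  by case: (ltgtP y k) h2 => // h2 _; [apply: OnE12|apply/AtV1/E; lra].
- case: (ltgtP (- k) y) h1 => // h1 _; last by apply/AtV3/E; lra.
  by case: (ltgtP y 0) h2 => // h2 _; [apply: OnE23|apply/AtV2/E; lra].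
- case: (ltgtP 0 x) h1 => // h1 _; last by apply/AtV3/E; lra.
  by case: (ltgtP x k) h2 => // h2 _; [apply: OnE31|apply/AtV1/E; lra].
Qed.

Lemma pt_neq p q : p <> q -> pt q p = 0.
Proof. by move=> /eqP/negbTE; rewrite /pt => ->. Qed.

Lemma pt_refl p : pt p p = 1.
Proof. by rewrite /pt eqxx. Qed.

(** The two sides can differ only at vertices, by 3 times the slope along the ray leaving there. The
    hypotheses say that the constant is not the strict maximum at V1, so that the slope along (1,1)
    is 1, and that X at V2 and Y at V3 are not the strict maximum, so that the slopes along (-1,0)
    and (0,-1) are 0. *)
Lemma mult_tl_ord k a b c p : 0 < k -> Cbar k p ->
  (a <= b + k \/ a <= c + k) -> (b - k <= a \/ b - k <= c) ->
  (c - k <= a \/ c - k <= b) ->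
  intersection_mult k (tl a b c) p = ord k (tl a b c) p + 3 * pt (V1 k) p.
Proof.
move=> k0 Cp h1 h2 h3; have [->|->|->|e e1 e2|e e1 e2|e e1 e2] := Cbar_cases Cp.
- rewrite mult_V1 // ord_V1 // pt_refl; congr (_ + 3 * _); rewrite slope_tl /slope3 /lexmax /=.
  have [i|i|i] := ltgtP (b + k) (c + k) => /=; rewrite /= ?i;
  match goal with |- context[ a < ?x ] => have [j|j|j] := ltgtP a x end;
    rewrite /= //; exfalso; lra.
- rewrite mult_V2 // ord_V2 // pt_neq ?mulr0; last by case=> ?; lra.
  congr (_ + _); rewrite slope_tl /slope3 /lexmax /=.
  have [i|i|i] := ltgtP (b - k) (c + 0) => /=;
  match goal with |- context[ a < ?x ] => have [j|j|j] := ltgtP a x end;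
    rewrite /= ?mulr0 //; exfalso; lra.
- rewrite mult_V3 // ord_V3 // pt_neq ?mulr0; last by case=> ?; lra.
  congr (_ + _); rewrite slope_tl /slope3 /lexmax /=.
  have [i|i|i] := ltgtP (b + 0) (c - k) => /=;
  match goal with |- context[ a < ?x ] => have [j|j|j] := ltgtP a x end;
    rewrite /= ?mulr0 //; exfalso; lra.
- by rewrite mult_E12 // ord_E12 // pt_neq ?mulr0 ?addr0 // => ep; rewrite ep /= in e2; lra.
- by rewrite mult_E23 // ord_E23 // pt_neq ?mulr0 ?addr0 // => ep; rewrite ep /= in e2; lra.
- by rewrite mult_E31 // ord_E31 // pt_neq ?mulr0 ?addr0 // => ep; rewrite ep /= in e2; lra.
Qed.

Definition in_triangle k (x y : R) : Prop :=
  [/\ - k < x - 2 * y, - k < x + y & - k < y - 2 * x].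

(* The points where the three rays of the tropical line with vertex (x, y),
   a point inside the triangle, meet its boundary. *)
Definition hit_left k (x y : R) : plane R :=
  if 0 <= y then (2 * y - k, y) else (- k - y, y).
Definition hit_down k (x y : R) : plane R :=
  if 0 <= x then (x, 2 * x - k) else (x, - k - x).
Definition hit_diag k (x y : R) : plane R :=
  if x <= y then (2 * (x - y) + k, x - y + k) else (k - (x - y), k - 2 * (x - y)).

(** From a vertex strictly inside, the leftward ray leaves the triangle through V1V2 or V2V3
    according to the sign of y, and it meets the boundary nowhere else. *)
Lemma hit_leftP k x y p : in_triangle k x y -> Cbar k p ->
  (p.2 = y /\ p.1 <= x) <-> p = hit_left k x y.
Proof.
move=> [i1 i2 i3] /CbarP; rewrite /hit_left /triangle_eqns; case: p => px py /= H.
case: (leP 0 y) => y0; split.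
- by case=> e1 e2; congr pair; lra.
- by case=> e1 e2; lra.
- by case=> e1 e2; congr pair; lra.
- by case=> e1 e2; lra.
Qed.

Lemma hit_downP k x y p : in_triangle k x y -> Cbar k p ->
  (p.1 = x /\ p.2 <= y) <-> p = hit_down k x y.
Proof.
move=> [i1 i2 i3] /CbarP; rewrite /hit_down /triangle_eqns; case: p => px py /= H.
case: (leP 0 x) => y0; split.
- by case=> e1 e2; congr pair; lra.
- by case=> e1 e2; lra.
- by case=> e1 e2; congr pair; lra.
- by case=> e1 e2; lra.
Qed.

Lemma hit_diagP k x y p : in_triangle k x y -> Cbar k p ->
  (p.1 - x = p.2 - y /\ x <= p.1) <-> p = hit_diag k x y.
Proof.
move=> [i1 i2 i3] /CbarP; rewrite /hit_diag /triangle_eqns; case: p => px py /= H.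
case: (leP x y) => y0; split.
- by case=> e1 e2; congr pair; lra.
- by case=> e1 e2; lra.
- by case=> e1 e2; congr pair; lra.
- by case=> e1 e2; lra.
Qed.

Lemma Cbar_hits k x y : in_triangle k x y ->
  [/\ Cbar k (hit_left k x y), Cbar k (hit_down k x y) & Cbar k (hit_diag k x y)].
Proof.
move=> [i1 i2 i3]; split; apply/CbarP; rewrite /hit_left /hit_down /hit_diag /triangle_eqns.
- by case: (leP 0 y) => h /=; lra.
- by case: (leP 0 x) => h /=; lra.
- by case: (leP x y) => h /=; lra.
Qed.

End Triangle.

Section InteriorVertex.
Variable R : realType.
Implicit Types (p q P Q M : plane R) (k a b c : R).

(** The three indicators become ties between monomials, after which both sides depend only on how a,
    b + X and c + Y compare at p. At a vertex the weight 3 makes the count right: a diagonal ray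
    through V1 has bounded slopes -1 and -1, and -1 - 1 + 3 = 1. *)
Lemma mult_tl_in_triangle k a b c p : 0 < k -> in_triangle k (a - b) (a - c) -> Cbar k p ->
  intersection_mult k (tl a b c) p =
  pt (hit_left k (a - b) (a - c)) p + pt (hit_down k (a - b) (a - c)) p
  + pt (hit_diag k (a - b) (a - c)) p.
Proof.
move=> k0 it Cp.
have -> : pt (hit_left k (a - b) (a - c)) p = ((a == c + p.2) && (b + p.1 <= a))%:Z.
  congr (_%:Z); congr (nat_of_bool _); apply/eqP/andP => [/(hit_leftP it Cp) [e h]|[/eqP e h]].
    by split; [apply/eqP; lra|lra].
  by apply/(hit_leftP it Cp); split; lra.
have -> : pt (hit_down k (a - b) (a - c)) p = ((a == b + p.1) && (c + p.2 <= a))%:Z.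
  congr (_%:Z); congr (nat_of_bool _); apply/eqP/andP => [/(hit_downP it Cp) [e h]|[/eqP e h]].
    by split; [apply/eqP; lra|lra].
  by apply/(hit_downP it Cp); split; lra.
have -> : pt (hit_diag k (a - b) (a - c)) p = ((b + p.1 == c + p.2) && (a <= b + p.1))%:Z.
  congr (_%:Z); congr (nat_of_bool _); apply/eqP/andP => [/(hit_diagP it Cp) [e h]|[/eqP e h]].
    by split; [apply/eqP; lra|lra].
  by apply/(hit_diagP it Cp); split; lra.
case: it => i1 i2 i3.
have [ep|ep|ep|e e1 e2|e e1 e2|e e1 e2] := Cbar_cases Cp; clear Cp;
  [rewrite {}ep mult_V1 // | rewrite {}ep mult_V2 // | rewrite {}ep mult_V3 // |
   rewrite mult_E12 // | rewrite mult_E23 // | rewrite mult_E31 //];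
rewrite !slope_tl /slope3 /lexmax /=;
match goal with |- context [b + ?x == c + ?y] =>
  have [i|i|i] := ltgtP (b + x) (c + y); have [j|j|j] := ltgtP a (b + x);
  have [l|l|l] := ltgtP a (c + y)
end; solve [exfalso; move: i j l; clear; lra | by [] | exfalso; lra].
Qed.

End InteriorVertex.

(** * Real coefficients on a box, and the line through two points *)

Section Lines.
Variable R : realType.
Implicit Types (p q P Q M : plane R) (f g h : plane R -> R) (k a b c : R).

Lemma nonsmooth_local f g p (c e : R) : 0 < e ->
  (forall q, `|q.1 - p.1| < e -> `|q.2 - p.2| < e -> f q = g q + c) ->
  nonsmooth f p <-> nonsmooth g p.
Proof.
have H f' g' (c' : R) : 0 < e ->
    (forall q, `|q.1 - p.1| < e -> `|q.2 - p.2| < e -> f' q = g' q + c') ->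
    differentiable (g' : plane R -> R^o) p -> differentiable (f' : plane R -> R^o) p.
  move=> e0 fg dg.
  apply: (@near_eq_differentiable _ _ _ (fun q => g' q + c' : R^o)).
    near=> q; have [h1 h2] : `|q.1 - p.1| < e /\ `|q.2 - p.2| < e.
      by near: q; exact: nbhs_box.
    by rewrite fg.
  by apply: differentiableD.
move=> e0 fg; split=> n d; apply: n; first exact: (H _ _ _ e0 fg d).
apply: (H g f (- c) e0 _ d) => q h1 h2; rewrite fg // addrK.
Unshelve. all: by end_near. Qed.

Lemma weighted_order_local (C : set (plane R)) dirs f g p (c e : R) : 0 < e ->
  (forall q, `|q.1 - p.1| < e -> `|q.2 - p.2| < e -> f q = g q + c) ->
  weighted_order C dirs f p = weighted_order C dirs g p.
Proof.
move=> e0 fg; apply: eq_bigr => w _; congr (_ * _); exact: slope_local fg.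
Qed.

Definition boxed (B : R) p := `|p.1| < B /\ `|p.2| < B.

Lemma boxed_near B p : boxed B p -> exists2 e : R, 0 < e &
  forall q, `|q.1 - p.1| < e -> `|q.2 - p.2| < e -> boxed B q.
Proof.
move=> [h1 h2]; exists (Num.min (B - `|p.1|) (B - `|p.2|)).
  by rewrite lt_min !subr_gt0 h1.
move=> q; rewrite !lt_min => /andP[q1 _] /andP[_ q2]; split.
  by have := ler_normD (q.1 - p.1) p.1; rewrite subrK; lra.
by have := ler_normD (q.2 - p.2) p.2; rewrite subrK; lra.
Qed.

Lemma trop_linear_tl a b c : trop_linear (tl a b c).
Proof.
exists a%:E, b%:E, c%:E; split; rewrite ?ltry // => p.
by rewrite -!EFinD -!EFin_max.
Qed.

(* A coefficient -oo can be replaced by a very negative real number as long as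
   only a bounded part of the plane matters. *)
Lemma trop_linear_boxed h B : trop_linear h ->
  exists a b c, forall p, boxed B p -> h p = tl a b c p.
Proof.
move=> [a [b [c [a1 b1 c1 hE]]]].
have E (x y z : R) : forall p, boxed B p -> forall m : R,
    [/\ x <= m, y + p.1 <= m & z + p.2 <= m] ->
    [\/ m = x, m = y + p.1 | m = z + p.2] -> m = tl x y z p.
  move=> p _ m [m1 m2 m3] H; have [k1 k2 k3 H'] := tlP x y z p.
  by apply/eqP; rewrite eq_le; apply/andP; split; [case: H|case: H'] => ->.
case: a a1 hE => [a| |] // _; case: b b1 => [b| |] // _; case: c c1 => [c| |] // _ hE.
- by exists a, b, c => p _; rewrite hE -!EFinD -!EFin_max.
(* On the box both coordinates lie strictly between -B and B, so a coefficient [a - B] keeps its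
   monomial below the constant a. The same margin gives [b - B] for a missing constant next to b +
   X, and [b - 2 * B] for a missing Y. *)
- exists a, b, (a - B) => p Bp; have [/ltr_normlP[p1 p1'] /ltr_normlP[p2 p2']] := Bp.
  rewrite hE addNye maxeNy -EFinD -EFin_max /=; have [i|i] := leP a (b + p.1);
  by apply: E Bp _ _ _; [split; lra|solve [constructor 1; done|constructor 2; done]].
- exists a, (a - B), c => p Bp; have [/ltr_normlP[p1 p1'] /ltr_normlP[p2 p2']] := Bp.
  rewrite hE addNye maxNye -EFinD -EFin_max /=; have [i|i] := leP a (c + p.2);
  by apply: E Bp _ _ _; [split; lra|solve [constructor 1; done|constructor 3; done]].
- exists a, (a - B), (a - B) => p Bp; have [/ltr_normlP[p1 p1'] /ltr_normlP[p2 p2']] := Bp.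
  rewrite hE !addNye maxNye maxeNy /=.
  by apply: E Bp _ _ _; [split; lra|constructor 1].
- exists (b - B), b, c => p Bp; have [/ltr_normlP[p1 p1'] /ltr_normlP[p2 p2']] := Bp.
  rewrite hE maxNye -!EFinD -EFin_max /=; have [i|i] := leP (b + p.1) (c + p.2);
  by apply: E Bp _ _ _; [split; lra|solve [constructor 2; done|constructor 3; done]].
- exists (b - B), b, (b - 2 * B) => p Bp; have [/ltr_normlP[p1 p1'] /ltr_normlP[p2 p2']] := Bp.
  rewrite hE addNye maxNye maxeNy -EFinD /=.
  by apply: E Bp _ _ _; [split; lra|constructor 2].
- exists (c - B), (c - 2 * B), c => p Bp; have [/ltr_normlP[p1 p1'] /ltr_normlP[p2 p2']] := Bp.
  rewrite hE addNye !maxNye -EFinD /=.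
  by apply: E Bp _ _ _; [split; lra|constructor 3].
(* All coefficients are -oo: [fine] makes h equal to 0, here the dominating constant. *)
- exists 0, (- B), (- B) => p Bp; have [/ltr_normlP[p1 p1'] /ltr_normlP[p2 p2']] := Bp.
  rewrite hE !addNye !maxNye /=.
  by apply: E Bp _ _ _; [split; lra|constructor 1].
Qed.

Lemma lt_or_gt (x y : R) : x <> y -> x < y \/ y < x.
Proof. by move=> /eqP; rewrite neq_lt => /orP. Qed.

(* The coefficients of the tropical cross product of the homogeneous vectors
   (0, P) and (0, Q). *)
Definition line_a P Q := Num.max (P.1 + Q.2) (P.2 + Q.1).
Definition line_b P Q := Num.max P.2 Q.2.
Definition line_c P Q := Num.max P.1 Q.1.
Definition line_fun P Q := tl (line_a P Q) (line_b P Q) (line_c P Q).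

(** A tropical determinant with a repeated row vanishes: at P the expansion consists of P.1 + Q.2,
    P.2 + Q.1 and P.1 + P.2, each occurring in two of the three monomials, so the maximum is
    attained twice. The same holds at Q. *)
Lemma line_fun_nonsmooth P Q : nonsmooth (line_fun P Q) P /\ nonsmooth (line_fun P Q) Q.
Proof.
rewrite !nonsmooth_tl /line_a /line_b /line_c /twice3.
have [i|i] := leP (P.1 + Q.2) (P.2 + Q.1); have [j|j] := leP P.2 Q.2; have [l|l] := leP P.1 Q.1;
split; solve [constructor 1; split; lra | constructor 2; split; lra | constructor 3; split; lra].
Qed.

(** Each point imposes a tie between two monomials. The same tie at P and Q contradicts generic
    position; different ties are two equations that fix b - a and c - a. *)
Lemma line_coefs a b c P Q : generic_position P Q ->
  twice3 a (b + P.1) (c + P.2) -> twice3 a (b + Q.1) (c + Q.2) ->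
  b - a = line_b P Q - line_a P Q /\ c - a = line_c P Q - line_a P Q.
Proof.
case: P Q => [p1 p2] [q1 q2]; rewrite /line_a /line_b /line_c /=.
move=> [/= /lt_or_gt g1 /lt_or_gt g2 /lt_or_gt g3] hP hQ.
case: g1 => g1; rewrite ?(max_l (ltW g1)) ?(max_r (ltW g1));
case: g2 => g2; rewrite ?(max_l (ltW g2)) ?(max_r (ltW g2));
have [i|i] := leP (p1 + q2) (p2 + q1); case: g3 => g3;
try (exfalso; move: i g1 g2 g3; clear; lra);
case: hP => -[P1 P2]; case: hQ => -[Q1 Q2]; split; lra.
Qed.

End Lines.

(** * Piecewise linearity as a local condition *)

Section PiecewiseLinear.
Variable R : realType.
Implicit Types (p q P Q M : plane R) (h g : plane R -> R) (k a b c : R) (f : R -> R).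

(** The supremum of the points up to which A holds satisfies A by the last hypothesis, and the
    preceding one pushes past it unless it is b. This glues local affine pieces together. *)
Lemma real_induction (A : R -> Prop) (a b : R) : a <= b -> A a ->
  (forall t, a <= t -> t < b -> A t ->
     exists2 e : R, 0 < e & forall s, t < s -> s <= t + e -> s <= b -> A s) ->
  (forall t, a < t -> t <= b -> (forall s, a <= s -> s < t -> A s) -> A t) ->
  forall t, a <= t -> t <= b -> A t.
Proof.
move=> ab Aa Ar Al.
pose S := [set t | [/\ a <= t, t <= b & forall s, a <= s -> s <= t -> A s]].
have Sa : S a.
  by split=> // s s1 s2; have -> : s = a by apply/eqP; rewrite eq_le s1 s2.
have hS : has_sup S by split; [exists a|exists b => t []].
pose T := sup S.
have aT : a <= T by apply: ub_le_sup => //; case: hS.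
have Tb : T <= b by apply: ge_sup; [exists a|move=> t []].
have AltT s : a <= s -> s < T -> A s.
  move=> s1 sT; have sT0 : 0 < T - s by rewrite subr_gt0.
  have [t [t1 t2 t3]] := sup_adherent sT0 hS.
  by rewrite -/T => st; apply: t3 => //; lra.
have AT : A T.
  by case: (ltgtP a T) aT => // [aT _|<- //]; exact: Al.
have AleT s : a <= s -> s <= T -> A s.
  by move=> s1; rewrite le_eqVlt => /predU1P[-> //|]; exact: AltT.
have bT : b <= T.
  rewrite leNgt; apply/negP => Tb'.
  have [e e0 he] := Ar _ aT Tb' AT.
  have m1 : Num.min (T + e) b <= T + e by rewrite ge_min lexx.
  have m2 : Num.min (T + e) b <= b by rewrite ge_min lexx orbT.
  have m3 : T < Num.min (T + e) b by rewrite lt_min Tb' ltrDl e0.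
  have : Num.min (T + e) b <= T.
    apply: ub_le_sup; first by case: hS.
    split=> //; first by lra.
    move=> s s1 s2; case: (leP s T) => sT; first exact: AleT.
    by apply: he => //; lra.
  by rewrite leNgt m3.
by move=> t t1 t2; apply: AleT => //; lra.
Qed.

Definition right_affine f t (m : int) : Prop :=
  exists2 e : R, 0 < e & forall s, t <= s -> s <= t + e -> f s = f t + m%:~R * (s - t).
Definition left_affine f t (m : int) : Prop :=
  exists2 e : R, 0 < e & forall s, t - e <= s -> s <= t -> f s = f t + m%:~R * (s - t).

Lemma piecewise_linear_extend f (t t' : R) (m : int) : t < t' ->
  (forall s, t <= s -> s <= t' -> f s = f t + m%:~R * (s - t)) ->
  piecewise_linear_int f t -> piecewise_linear_int f t'.
Proof.
move=> tt' ft [n [s [ms [s0 sn slt fE]]]].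
exists n.+1, (fun i => if (i <= n)%N then s i else t'), (fun i => if (i < n)%N then ms i else m).
split=> [//||i|i x].
- by rewrite ltnn.
- rewrite ltnS => iltn; rewrite iltn; case: ltnP => iin; first exact: slt.
  have -> : i = n by apply/eqP; rewrite eqn_leq iltn.
  by rewrite sn.
- rewrite ltnS => iltn; rewrite iltn; case: ltnP => iin; first exact: fE.
  have -> : i = n by apply/eqP; rewrite eqn_leq iltn.
  by rewrite sn => /andP[]; exact: ft.
Qed.

(** Compactness of [0, l] turns one-sided affine germs into a finite partition, built by adding one
    break point at a time. The local form passes to differences without a common refinement of
    partitions. *)
Lemma piecewise_linearP f (l : R) : 0 <= l -> piecewise_linear_int f l <->
  (forall t, 0 <= t -> t < l -> exists m, right_affine f t m) /\
  (forall t, 0 < t -> t <= l -> exists m, left_affine f t m).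
Proof.
move=> l0; split.
  move=> [n [s [m [s0 sn slt fE]]]]; split=> t t0 tl.
    have [i iltn [h1 h2]] : exists2 i, (i < n)%N & s i <= t /\ t < s i.+1.
      rewrite -sn in tl; clear sn fE l0; elim: n slt tl => [|n IH] slt tl.
        by move: t0; rewrite -s0 => t0; exfalso; lra.
      case: (ltP t (s n)) => tn; last by exists n.
      have [i iltn h] := IH (fun i lt_in => slt i (ltnW lt_in)) tn.
      by exists i => //; exact: ltnW.
    exists (m i), (s i.+1 - t); first by lra.
    move=> x x1 x2.
    have -> : f x = f (s i) + (m i)%:~R * (x - s i) by apply: fE => //; apply/andP; split; lra.
    have -> : f t = f (s i) + (m i)%:~R * (t - s i) by apply: fE => //; apply/andP; split; lra.
    ring.
  have [i iltn [h1 h2]] : exists2 i, (i < n)%N & s i < t /\ t <= s i.+1.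
    rewrite -sn in tl; clear sn fE l0; elim: n slt tl => [|n IH] slt tl.
      by move: t0; rewrite -s0 => t0; exfalso; lra.
    case: (leP t (s n)) => tn; last by exists n.
    have [i iltn h] := IH (fun i lt_in => slt i (ltnW lt_in)) tn.
    by exists i => //; exact: ltnW.
  exists (m i), (t - s i); first by lra.
  move=> x x1 x2.
  have -> : f x = f (s i) + (m i)%:~R * (x - s i) by apply: fE => //; apply/andP; split; lra.
  have -> : f t = f (s i) + (m i)%:~R * (t - s i) by apply: fE => //; apply/andP; split; lra.
  ring.
move=> [hr hl]; apply: (@real_induction _ 0 l) => //; last 1 first.
- move=> t t0 tl IH; have [m [e e0 he]] := hl t t0 tl.
  pose s := Num.max 0 (t - e).
  have s1 : 0 <= s by rewrite /s le_max lexx.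
  have s2 : t - e <= s by rewrite /s le_max lexx orbT.
  have s3 : s < t by rewrite /s gt_max t0; lra.
  apply: (@piecewise_linear_extend f s t m) => //; last exact: IH.
  move=> x x1 x2; rewrite he //; last by lra.
  rewrite [f s]he //; last by lra.
  ring.
- by exists 0%N, (fun=> 0), (fun=> 0).
- move=> t t0 tl IH; have [m [e e0 he]] := hr t t0 tl.
  exists e => // s s1 s2 _; apply: piecewise_linear_extend IH => // x x1 x2.
  by apply: he => //; lra.
Qed.

Definition opp_dir (u : int * int) := (- u.1, - u.2).

Lemma right_affine_slope h p u t m :
  right_affine (fun t => h (move p u t)) t m <-> slope_at h (move p u t) u m.
Proof.
have E (s : R) : move (move p u t) u s = move p u (t + s).
  by rewrite /move /=; congr pair; ring.
split=> -[d d0 hd].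
  by exists d => // s s0 sd; rewrite E hd; [|lra|lra]; rewrite addrAC subrr add0r.
exists (d / 2); first by lra.
move=> s; rewrite le_eqVlt => /predU1P[<- _|ts sd]; first by rewrite subrr mulr0 addr0.
by rewrite -hd; [|lra|lra]; rewrite E subrKC.
Qed.

(** The outgoing direction runs against the parameter, hence the change of sign. *)
Lemma left_affine_slope h p u t m :
  left_affine (fun t => h (move p u t)) t m <-> slope_at h (move p u t) (opp_dir u) (- m).
Proof.
have E (s : R) : move (move p u t) (opp_dir u) s = move p u (t - s).
  by rewrite /move /= !rmorphN /=; congr pair; ring.
split=> -[d d0 hd].
  by exists d => // s s0 sd; rewrite E hd ?rmorphN /=; [ring|lra|lra].
exists (d / 2); first by lra.
move=> s sd; rewrite le_eqVlt => /predU1P[<-|ts]; first by rewrite subrr mulr0 addr0.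
have := hd (t - s); rewrite E subKr => ->; [|lra|lra].
by rewrite rmorphN /=; ring.
Qed.

Lemma rational_function_slopes k h v u t : 0 <= k -> rational_function k h ->
  (v, u) \in edges k ->
  (0 <= t -> t < k -> exists m, slope_at h (move v u t) u m) /\
  (0 < t -> t <= k -> exists m, slope_at h (move v u t) (opp_dir u) m).
Proof.
move=> k0 [_ /(_ (v, u))] H /H /(piecewise_linearP _ k0) [hr hl]; split=> t1 t2.
  by have [m /right_affine_slope] := hr t t1 t2; exists m.
by have [m /left_affine_slope] := hl t t1 t2; exists (- m).
Qed.

Lemma rational_function_of_slopes k h : 0 <= k ->
  {within Cbar k, continuous (h : plane R -> R^o)} ->
  (forall p u, Cbar k p -> exists m, slope_at h p u m) -> rational_function k h.
Proof.
move=> k0 hc hs; split=> // -[v u] ve /=; apply/piecewise_linearP => //.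
have C t : 0 <= t -> t <= k -> Cbar k (move v u t).
  by move=> t0 tk; exists (v, u), t; rewrite t0 tk.
split=> t t0 tk.
  have [|m hm] := hs (move v u t) u; first by apply: C => //; exact: ltW.
  by exists m; apply/right_affine_slope.
have [|m hm] := hs (move v u t) (opp_dir u); first by apply: C => //; exact: ltW.
by exists (- m); apply/left_affine_slope; rewrite opprK.
Qed.

Lemma rational_functionB k h g : 0 <= k -> rational_function k h ->
  rational_function k g -> rational_function k (fun p => h p - g p).
Proof.
move=> k0 [hc hpl] [gc gpl]; split.
  by move=> x; exact: (@continuousB R R^o (subspace (Cbar k)) h g x (hc x) (gc x)).
move=> e ee; have /(piecewise_linearP _ k0) [hr hl] := hpl e ee.
have /(piecewise_linearP _ k0) [gr gl] := gpl e ee.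
apply/(piecewise_linearP _ k0); split=> t t0 tk.
  have [m [d d0 hd]] := hr t t0 tk; have [n [d' d0' gd]] := gr t t0 tk.
  exists (m - n), (Num.min d d'); first by rewrite lt_min d0.
  move=> s s1 s2.
  have m1 : Num.min d d' <= d by rewrite ge_min lexx.
  have m2 : Num.min d d' <= d' by rewrite ge_min lexx orbT.
  have /= -> := hd s s1 (le_trans s2 (lerD (lexx t) m1)).
  have /= -> := gd s s1 (le_trans s2 (lerD (lexx t) m2)).
  by rewrite rmorphB /=; ring.
have [m [d d0 hd]] := hl t t0 tk; have [n [d' d0' gd]] := gl t t0 tk.
exists (m - n), (Num.min d d'); first by rewrite lt_min d0.
move=> s s1 s2.
have m1 : Num.min d d' <= d by rewrite ge_min lexx.
have m2 : Num.min d d' <= d' by rewrite ge_min lexx orbT.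
have /= -> := hd s (le_trans (lerB (lexx t) m1) s1) s2.
have /= -> := gd s (le_trans (lerB (lexx t) m2) s1) s2.
by rewrite rmorphB /=; ring.
Qed.

End PiecewiseLinear.

(** * A function on a circle cannot have one simple zero and one simple pole *)

Section Injectivity.
Variable R : realType.
Implicit Types (p q P Q M : plane R) (h g : plane R -> R) (k a b c : R) (f : R -> R).

Lemma affine_right f (s t : R) (m : int) : s < t ->
  (forall x, s <= x -> x <= t -> f x = f s + m%:~R * (x - s)) -> right_affine f s m.
Proof.
move=> st fE; exists (t - s); first by rewrite subr_gt0.
by move=> x x1 x2; apply: fE => //; lra.
Qed.

Lemma affine_left f (s t : R) (m : int) : s < t ->
  (forall x, s <= x -> x <= t -> f x = f s + m%:~R * (x - s)) -> left_affine f t m.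
Proof.
move=> st fE; exists (t - s); first by rewrite subr_gt0.
move=> x x1 x2; rewrite fE //; last by lra.
rewrite [f t]fE //; last exact: ltW.
ring.
Qed.

Lemma right_affine_inj f t m n : right_affine f t m -> right_affine f t n -> m = n.
Proof.
move=> [d d0 hd] [e e0 he]; have [x x0 [xd xe]] := small_step d0 e0.
have tx : t <= t + x by lra.
have H : m%:~R * (t + x - t) = n%:~R * (t + x - t) :> R.
  by apply: (addrI (f t)); rewrite -hd -?he //; lra.
apply/eqP; rewrite -(eqr_int R); apply/eqP; apply: (mulIf _ H).
by rewrite addrAC subrr add0r gt_eqF.
Qed.

Lemma left_affine_inj f t m n : left_affine f t m -> left_affine f t n -> m = n.
Proof.
move=> [d d0 hd] [e e0 he]; have [x x0 [xd xe]] := small_step d0 e0.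
have tx : t - x <= t by lra.
have H : m%:~R * (t - x - t) = n%:~R * (t - x - t) :> R.
  by apply: (addrI (f t)); rewrite -hd -?he //; lra.
apply/eqP; rewrite -(eqr_int R); apply/eqP; apply: (mulIf _ H).
by rewrite addrAC subrr add0r oppr_eq0 gt_eqF.
Qed.

(** Without a kink strictly inside, the initial slope propagates by real induction; [A] records the
    value and both one-sided slopes, so that each step can restart from t. *)
Lemma affine_between f (a b : R) m n : a < b ->
  (forall t, a < t -> t < b -> exists2 l, left_affine f t l & right_affine f t l) ->
  right_affine f a m -> left_affine f b n -> m = n /\ f b = f a + m%:~R * (b - a).
Proof.
move=> ab fab fa fb.
pose A t := [/\ f t = f a + m%:~R * (t - a), a < t -> left_affine f t m &
   t < b -> right_affine f t m].
suff /(_ b (ltW ab) (lexx b)) [E /(_ ab) fb' _] :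
    forall t, a <= t -> t <= b -> A t.
  by split=> //; exact: left_affine_inj fb' fb.
apply: (@real_induction _ A a b) => //; first exact: ltW.
- by split=> //; rewrite ?subrr ?mulr0 ?addr0 // ltxx.
- move=> t at_ tb [ft _ /(_ tb) [e e0 fr]]; exists e => // s ts se sb.
  have fs : forall x, t <= x -> x <= s -> f x = f t + m%:~R * (x - t).
    by move=> x x1 x2; apply: fr => //; lra.
  have fl : left_affine f s m := affine_left ts fs.
  split=> // [|sb'].
    by rewrite fr ?ft //; [ring|exact: ltW].
  have [l l1 l2] := fab s (le_lt_trans at_ ts) sb'.
  by rewrite (left_affine_inj fl l1).
- move=> t at_ tb IH.
  have [l [l1 l2]] : exists l, left_affine f t l /\ (t < b -> right_affine f t l).
    case: (ltP t b) => tb'; first by have [l l1 l2] := fab t at_ tb'; exists l.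
    have -> : t = b by apply/eqP; rewrite eq_le tb.
    by exists n.
  have [e e0 le] := l1.
  pose s := Num.max a (t - e).
  have s1 : a <= s by rewrite /s le_max lexx.
  have s2 : t - e <= s by rewrite /s le_max lexx orbT.
  have s3 : s < t by rewrite /s gt_max at_; lra.
  have fs : forall x, s <= x -> x <= t -> f x = f s + l%:~R * (x - s).
    move=> x x1 x2; rewrite le //; last by lra.
    rewrite [f s]le //; last by lra.
    ring.
  have [fsE _ fsr] := IH s s1 s3.
  have ml : m = l.
    by apply: right_affine_inj (fsr _) (affine_right s3 fs); exact: lt_le_trans s3 tb.
  rewrite /A ml; split=> //.
  by rewrite (fs t) ?fsE ?ml //; [ring|exact: ltW].
Qed.

Lemma int_mul_small_eq0 (m : int) (L x : R) : 0 < L -> m%:~R * L = x ->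
  - L < x -> x < L -> x = 0.
Proof.
move=> L0 mx x1 x2; case: (ltgtP m 0) => [m0|m0|m0].
- have : (m%:~R : R) <= (-1)%:~R by rewrite ler_int; lia.
  move=> mle; have {}mle : (m%:~R : R) <= -1 by [].
  by rewrite -mx in x1 *; nra.
- have : 1%:~R <= (m%:~R : R) by rewrite ler_int; lia.
  move=> mge; have {}mge : 1 <= (m%:~R : R) by [].
  by rewrite -mx in x2 *; nra.
- by rewrite -mx m0 mul0r.
Qed.

(* The slope of a periodic f would have to change by eps at s and by -eps at
   s', and its average over a period is 0: this makes the length of one of the
   two arcs an integral multiple of the period L. *)
Lemma no_simple_pole f (L s s' : R) (eps : int) (dlt : R -> int) :
  eps = 1 \/ eps = -1 ->
  0 <= s -> s < s' -> s' < L ->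
  dlt s = eps -> dlt s' = - eps -> (forall t, t <> s -> t <> s' -> dlt t = 0) ->
  f 0 = f L ->
  (forall t, 0 < t -> t < L ->
     exists m n, [/\ left_affine f t m, right_affine f t n & n - m = dlt t]) ->
  (exists m n, [/\ left_affine f L m, right_affine f 0 n & n - m = dlt 0]) -> False.
Proof.
move=> he s0 ss' s'L ds ds' d0 fper fint [mL [n0 [hL h0 hd]]].
have L0 : 0 < L by lra.
have he' : (eps%:~R : R) = 1 \/ (eps%:~R : R) = -1 by case: he => ->; [left|right].
have smooth t : 0 < t -> t < L -> (t < s \/ s < t) -> (t < s' \/ s' < t) ->
    exists2 l, left_affine f t l & right_affine f t l.
  move=> t0 tL /orP; rewrite -neq_lt => /eqP ts /orP; rewrite -neq_lt => /eqP ts'.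
  have [m [n [h1 h2]]] := fint t t0 tL.
  by rewrite d0 // => /eqP; rewrite subr_eq0 => /eqP e; exists m => //; rewrite -e.
have [m1 [m2 [l1 r2 e2]]] := fint s' (le_lt_trans s0 ss') s'L.
have [E2 fL] : m2 = mL /\ f L = f s' + m2%:~R * (L - s').
  apply: affine_between => // t t1 t2; apply: smooth => //; lra.
(* For s > 0 the slopes on the three arcs are m0, m0 + eps, m0, and equal end values give m0 L = -
   eps (s' - s). A multiple of L of absolute value below L is 0, against s < s'. *)
case: (ltgtP 0 s) s0 => // [s0|s0] _.
  have [m0 [m1' [l0 r1 e1]]] := fint s s0 (lt_trans ss' s'L).
  have [E0 fs] : n0 = m0 /\ f s = f 0 + n0%:~R * (s - 0).
    by apply: affine_between => // t t1 t2; apply: smooth => //; lra.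
  have [E1 fs'] : m1' = m1 /\ f s' = f s + m1'%:~R * (s' - s).
    by apply: affine_between => // t t1 t2; apply: smooth => //; lra.
  have M1 : m1' = m0 + eps by rewrite ds in e1; rewrite -e1; ring.
  have M2 : m2 = m0 by rewrite ds' -E1 M1 in e2; lia.
  have X : m0%:~R * L = - (eps%:~R * (s' - s)).
    by move: fL; rewrite fs' fs E0 M1 M2 -fper rmorphD /=; lra.
  have := int_mul_small_eq0 L0 X; case: he' => ->; lra.
(* For s = 0 two arcs remain, with slopes m1 and m1 - eps, and now eps (L - s') would be a multiple
   of L. *)
rewrite -s0 in ds ss' *.
have [E1 fs'] : n0 = m1 /\ f s' = f 0 + n0%:~R * (s' - 0).
  by apply: affine_between => // t t1 t2; apply: smooth => //; lra.
have M2 : m2 = m1 - eps by rewrite ds' in e2; lia.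
have X : m1%:~R * L = eps%:~R * (L - s').
  by move: fL; rewrite fs' E1 M2 -fper rmorphB /=; lra.
have := int_mul_small_eq0 L0 X; case: he' => ->; lra.
Qed.

End Injectivity.

(** * The boundary as a cycle, and uniqueness of sums *)

Section Group.
Variable R : realType.
Implicit Types (p q P Q M S : plane R) (h g : plane R -> R) (k a b c : R) (f : R -> R).

(** Parametrization by lattice length from V1 through V2 and V3, with total length 3 k. Neighbouring
    formulas agree at k and 2 k, so each holds on its closed edge. *)
Definition cycle k (t : R) : plane R :=
  if t <= k then move (V1 k) (-2, -1) t
  else if t <= 2 * k then move (V2 k) (1, -1) (t - k)
  else move (V3 k) (1, 2) (t - 2 * k).

Lemma cycle1 k t : t <= k -> cycle k t = move (V1 k) (-2, -1) t.
Proof. by rewrite /cycle => ->. Qed.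

Lemma cycle2 k t : k <= t -> t <= 2 * k -> cycle k t = move (V2 k) (1, -1) (t - k).
Proof.
rewrite /cycle => kt kt2; rewrite kt2; case: (leP t k) => // tk.
by rewrite /move /V1 /V2 /V3 /=; congr pair; lra.
Qed.

Lemma cycle3 k t : 0 < k -> 2 * k <= t -> cycle k t = move (V3 k) (1, 2) (t - 2 * k).
Proof.
rewrite /cycle => k0 kt; case: (leP t k) => [tk|_]; first by exfalso; lra.
by case: (leP t (2 * k)) => // tk; rewrite /move /V1 /V2 /V3 /=; congr pair; lra.
Qed.

Lemma cycle_inj k s t : 0 < k -> 0 <= s -> s < 3 * k -> 0 <= t -> t < 3 * k ->
  cycle k s = cycle k t -> s = t.
Proof.
move=> k0 s0 s1 t0 t1; rewrite /cycle /move /V1 /V2 /V3.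
case: (leP s k) => s2; [|case: (leP s (2 * k)) => s3];
(case: (leP t k) => t2; [|case: (leP t (2 * k)) => t3]) => -[/=]; lra.
Qed.

Lemma cycle_surj k p : 0 < k -> Cbar k p -> exists2 t, 0 <= t < 3 * k & p = cycle k t.
Proof.
move=> k0; case: p => x y /CbarP [|[|]] /= [e [h1 h2]].
- exists (k - y); first by lra.
  by rewrite cycle1 /move /V1 /V2 /V3 /=; [congr pair; lra|lra].
- exists (k - y); first by lra.
  by rewrite cycle2 /move /V1 /V2 /V3 /=; [congr pair; lra|lra|lra].
- have [xk|xk] := ltP x k.
    exists (2 * k + x); first by lra.
    by rewrite cycle3 /move /V1 /V2 /V3 /=; [congr pair; lra|lra|lra].
  (* The end x = k of this edge is V1, whose parameter in the half-open range is 0. *)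
  exists 0; first by lra.
  by rewrite cycle1 /move /V1 /V2 /V3 /=; [congr pair; lra|lra].
Qed.

(** The curve is closed, so near p no direction meets it and the sum is empty. *)
Lemma ord_out k h p : ~ Cbar k p -> ord k h p = 0.
Proof.
move=> Cp; rewrite /ord /weighted_order big1_seq // => -[w u] /andP[/asboolP/near_right0 H _].
exfalso; case: H => d d0 hd.
suff [e e0 he] : exists2 e : R, 0 < e & forall q, `|q.1 - p.1| < e -> `|q.2 - p.2| < e ->
    ~ triangle_eqns k q.1 q.2.
  have [d1 d10 h1] := near_right0_mul_lt `|u.1%:~R| e0.
  have [d2 d20 h2] := near_right0_mul_lt `|u.2%:~R| e0.
  have m0 : 0 < Num.min d (Num.min d1 d2) by rewrite !lt_min d0 d10.
  have : Num.min d (Num.min d1 d2) / 2 < Num.min d (Num.min d1 d2) by lra.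
  rewrite [X in _ < X -> _]/= !lt_min => /and3P[td td1 td2].
  have t0 : 0 < Num.min d (Num.min d1 d2) / 2 by rewrite divr_gt0.
  have /= /CbarP := hd _ t0 td; apply: he;
    rewrite /move /= [_ + _ * _]addrC addrK normrM (gtr0_norm t0).
    exact: h1.
  exact: h2.
suff : \forall q \near p, ~ triangle_eqns k q.1 q.2.
  move=> /nbhs_ballP[e /= e0 he]; exists e => // q q1 q2; apply: he.
  by split; rewrite /ball /= distrC.
(* Off the boundary, p lies strictly beyond one of the edge lines or strictly inside all three;
   either condition is open. *)
have [H|[H|[H|[H1 [H2 H3]]]]] : 0 < 2 * p.1 - p.2 - k \/ 0 < 2 * p.2 - p.1 - k \/
    0 < - k - p.1 - p.2 \/
    (2 * p.1 - p.2 - k < 0 /\ 2 * p.2 - p.1 - k < 0 /\ - k - p.1 - p.2 < 0).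
- apply: contrapT => H; apply: Cp; apply/CbarP; move: H; rewrite /triangle_eqns.
  by clear d d0 hd; case: p => x y /=; case: (ltgtP 0 (2 * x - y - k)) => i;
  case: (ltgtP 0 (2 * y - x - k)) => j; case: (ltgtP 0 (- k - x - y)) => l H;
  try (by exfalso; apply: H; tauto); try (by left; lra); try (by right; left; lra);
  try (by right; right; lra); lra.
- have := @near_affine_lt R _ _ (0, 0) (2, -1) p H.
  by apply: filterS => q; rewrite /affine_at /triangle_eqns /=; lra.
- have := @near_affine_lt R _ _ (0, 0) (-1, 2) p H.
  by apply: filterS => q; rewrite /affine_at /triangle_eqns /=; lra.
- have := @near_affine_lt R _ _ (0, 0) (-1, -1) p H.
  by apply: filterS => q; rewrite /affine_at /triangle_eqns /=; lra.
- have := @near_affine_lt R _ _ (2, -1) (0, 0) p H1.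
  have := @near_affine_lt R _ _ (-1, 2) (0, 0) p H2.
  have := @near_affine_lt R _ _ (-1, -1) (0, 0) p H3.
  by apply: filterS3 => q; rewrite /affine_at /triangle_eqns /=; lra.
Qed.

Lemma right_affine_shift f f' (o x l : R) m : x < l ->
  (forall s, 0 <= s -> s <= l -> f (o + s) = f' s) -> 0 <= x ->
  right_affine f' x m -> right_affine f (o + x) m.
Proof.
move=> xl ff' x0 [e e0 he]; exists (Num.min e (l - x)); first by rewrite lt_min e0 subr_gt0.
move=> s s1 s2.
have m1 : Num.min e (l - x) <= e by rewrite ge_min lexx.
have m2 : Num.min e (l - x) <= l - x by rewrite ge_min lexx orbT.
have := ff' (s - o); rewrite subrKC => ->; [|lra|lra].
rewrite he ?ff' //; [|exact: ltW|lra|lra].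
by congr (_ + _ * _); ring.
Qed.

Lemma left_affine_shift f f' (o x l : R) m : 0 < x ->
  (forall s, 0 <= s -> s <= l -> f (o + s) = f' s) -> x <= l ->
  left_affine f' x m -> left_affine f (o + x) m.
Proof.
move=> x0 ff' xl [e e0 he]; exists (Num.min e x); first by rewrite lt_min e0.
move=> s s1 s2.
have m1 : Num.min e x <= e by rewrite ge_min lexx.
have m2 : Num.min e x <= x by rewrite ge_min lexx orbT.
have := ff' (s - o); rewrite subrKC => ->; [|lra|lra].
rewrite he ?ff' //; [|exact: ltW|lra|lra].
by congr (_ + _ * _); ring.
Qed.

(** The edge along which the cycle leaves t, and in [dir_left] the one along which it arrives; at a
    corner they differ. The offset o is the parameter where the edge starts. *)
Definition dir_right k (t : R) (u : int * int) := exists v (o : R),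
  [/\ (v, u) \in edges k, (forall s, 0 <= s -> s <= k -> cycle k (o + s) = move v u s),
     o <= t & t < o + k].
Definition dir_left k (t : R) (u : int * int) := exists v (o : R),
  [/\ (v, u) \in edges k, (forall s, 0 <= s -> s <= k -> cycle k (o + s) = move v u s),
     o < t & t <= o + k].

Lemma dir_right_slope k h t u : 0 < k -> rational_function k h -> dir_right k t u ->
  right_affine (h \o cycle k) t (slope h (cycle k t) u) /\
  slope_at h (cycle k t) u (slope h (cycle k t) u).
Proof.
move=> k0 hrat [v [z [ve oE t0 tk]]].
have x0 : 0 <= t - z by lra.
have xk : t - z < k by lra.
have ct : cycle k t = move v u (t - z) by rewrite -oE ?subrKC // ltW.
have [H _] := rational_function_slopes (t - z) (ltW k0) hrat ve.
have [m hm] := H x0 xk; rewrite ct (slopeE hm); split=> //.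
rewrite -[t in right_affine _ t](subrKC z).
apply: (@right_affine_shift _ (fun s => h (move v u s)) z (t - z) k) => //.
  by move=> s s0 sk /=; rewrite oE.
exact/right_affine_slope.
Qed.

Lemma dir_left_slope k h t u : 0 < k -> rational_function k h -> dir_left k t u ->
  left_affine (h \o cycle k) t (- slope h (cycle k t) (opp_dir u)) /\
  slope_at h (cycle k t) (opp_dir u) (slope h (cycle k t) (opp_dir u)).
Proof.
move=> k0 hrat [v [z [ve oE t0 tk]]].
have x0 : 0 < t - z by lra.
have xk : t - z <= k by lra.
have ct : cycle k t = move v u (t - z) by rewrite -oE ?subrKC // ltW.
have [_ H] := rational_function_slopes (t - z) (ltW k0) hrat ve.
have [m hm] := H x0 xk; rewrite ct (slopeE hm); split=> //.
rewrite -[t in left_affine _ t](subrKC z).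
apply: (@left_affine_shift _ (fun s => h (move v u s)) z (t - z) k) => //.
  by move=> s s0 sk /=; rewrite oE.
by apply/left_affine_slope; rewrite opprK.
Qed.

Lemma cycle_edge1 k : (V1 k, (-2, -1)) \in edges k /\
  forall s, 0 <= s -> s <= k -> cycle k (0 + s) = move (V1 k) (-2, -1) s.
Proof. by split=> [|s s0 sk]; rewrite ?inE ?eqxx // add0r cycle1. Qed.

Lemma cycle_edge2 k : (V2 k, (1, -1)) \in edges k /\
  forall s, 0 <= s -> s <= k -> cycle k (k + s) = move (V2 k) (1, -1) s.
Proof.
split=> [|s s0 sk]; first by rewrite !inE eqxx orbT.
by rewrite cycle2; [rewrite addrC addKr|lra|lra].
Qed.

Lemma cycle_edge3 k : 0 < k -> (V3 k, (1, 2)) \in edges k /\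
  forall s, 0 <= s -> s <= k -> cycle k (2 * k + s) = move (V3 k) (1, 2) s.
Proof.
move=> k0; split=> [|s s0 sk]; first by rewrite !inE eqxx !orbT.
by rewrite cycle3 //; [rewrite addrC addKr|lra].
Qed.

Lemma cycle_V1 k : 0 < k -> cycle k 0 = V1 k /\ cycle k (3 * k) = V1 k.
Proof.
move=> k0; rewrite cycle1 ?ltW // cycle3 //; last by lra.
by rewrite /move /V1 /V3 /=; split; congr pair; lra.
Qed.

Lemma ord_cycle_V1 k : 0 < k -> [/\ dir_right k 0 (-2, -1), dir_left k (3 * k) (1, 2) &
  forall h, ord k h (V1 k) = slope h (V1 k) (-2, -1) + slope h (V1 k) (opp_dir (1, 2))].
Proof.
move=> k0; have [e1 h1] := cycle_edge1 k; have [e3 h3] := cycle_edge3 k0.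
split; last by move=> h; rewrite ord_V1.
- by exists (V1 k), 0; split=> //; lra.
- by exists (V3 k), (2 * k); split=> //; lra.
Qed.

(** This reads the order as the jump of slope of h along the cycle. The directions are chosen before
    h, so two functions can be compared along the same ones. *)
Lemma ord_cycle k t : 0 < k -> 0 < t -> t < 3 * k -> exists u u',
  [/\ dir_right k t u, dir_left k t u' &
  forall h, ord k h (cycle k t) = slope h (cycle k t) u + slope h (cycle k t) (opp_dir u')].
Proof.
move=> k0 t0 t3; have [e1 h1] := cycle_edge1 k.
have [e2 h2] := cycle_edge2 k; have [e3 h3] := cycle_edge3 k0.
have V2E : cycle k k = V2 k by rewrite cycle1 // /move /V1 /V2 /=; congr pair; lra.
have V3E : cycle k (2 * k) = V3 k.
  by rewrite cycle3 // /move /V3 /=; congr pair; lra.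
case: (ltgtP t k) => tk; last 1 first.
- exists (1, -1), (-2, -1); rewrite tk V2E; split; last by move=> h; rewrite ord_V2 // addrC.
    by exists (V2 k), k; split=> //; lra.
  by exists (V1 k), 0; split=> //; lra.
- exists (-2, -1), (-2, -1); split.
  + by exists (V1 k), 0; split=> //; lra.
  + by exists (V1 k), 0; split=> //; lra.
  + move=> h; rewrite cycle1 ?(ltW tk) // ord_E12 //; [exact: addrC|..]; rewrite /move /V1 /=; lra.
case: (ltgtP t (2 * k)) => t2k; last 1 first.
- exists (1, 2), (1, -1); rewrite t2k V3E; split; last by move=> h; rewrite ord_V3.
    by exists (V3 k), (2 * k); split=> //; lra.
  by exists (V2 k), k; split=> //; lra.
- exists (1, -1), (1, -1); split.
  + by exists (V2 k), k; split=> //; lra.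
  + by exists (V2 k), k; split=> //; lra.
  + move=> h; rewrite cycle2 ?(ltW tk) ?(ltW t2k) // ord_E23 //; rewrite /move /V2 /=; lra.
- exists (1, 2), (1, 2); split.
  + by exists (V3 k), (2 * k); split=> //; lra.
  + by exists (V3 k), (2 * k); split=> //; lra.
  + move=> h; rewrite cycle3 ?(ltW t2k) // ord_E31 //; rewrite /move /V3 /=; lra.
Qed.

(** Slopes subtract only where they exist: rational functions have them along the edges, and off the
    curve all orders are 0. *)
Lemma ordB k h g p : 0 < k -> rational_function k h -> rational_function k g ->
  ord k (fun q => h q - g q) p = ord k h p - ord k g p.
Proof.
move=> k0 hr gr; case: (pselect (Cbar k p)) => Cp; last by rewrite !ord_out // subr0.
have hgr := rational_functionB (ltW k0) hr gr.
have [t /andP[t0 t3] ->] := cycle_surj k0 Cp.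
move: t0; rewrite le_eqVlt => /predU1P[<-|t0].
  have [d1 d2 E] := ord_cycle_V1 k0; have [E0 E3] := cycle_V1 k0; rewrite E0 !E.
  have [_ ha] := dir_right_slope k0 hr d1; have [_ ga] := dir_right_slope k0 gr d1.
  have [_ hb] := dir_left_slope k0 hr d2; have [_ gb] := dir_left_slope k0 gr d2.
  rewrite E0 in ha ga; rewrite E3 in hb gb.
  by rewrite (slopeE (slope_at_sub ha ga)) (slopeE (slope_at_sub hb gb)); ring.
have [u [u' [d1 d2 E]]] := ord_cycle k0 t0 t3; rewrite !E.
have [_ ha] := dir_right_slope k0 hr d1; have [_ ga] := dir_right_slope k0 gr d1.
have [_ hb] := dir_left_slope k0 hr d2; have [_ gb] := dir_left_slope k0 gr d2.
by rewrite (slopeE (slope_at_sub ha ga)) (slopeE (slope_at_sub hb gb)); ring.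
Qed.

Lemma phi_injective k h S M : 0 < k -> Cbar k S -> Cbar k M ->
  has_divisor k h (fun p => pt S p - pt M p) -> S = M.
Proof.
move=> k0 /(cycle_surj k0)[s /andP[s0 s3] ->] /(cycle_surj k0)[s' /andP[s0' s3'] ->] [hr hd].
have [E0 E3] := cycle_V1 k0.
have fint t : 0 < t -> t < 3 * k -> exists m n, [/\ left_affine (h \o cycle k) t m,
    right_affine (h \o cycle k) t n & n - m = (t == s)%:Z - (t == s')%:Z].
  move=> t0 t3; have [u [u' [d1 d2 E]]] := ord_cycle k0 t0 t3.
  have [ha _] := dir_right_slope k0 hr d1; have [hb _] := dir_left_slope k0 hr d2.
  exists (- slope h (cycle k t) (opp_dir u')), (slope h (cycle k t) u); split=> //.
  rewrite opprK -E hd /pt; congr ((nat_of_bool _)%:Z - (nat_of_bool _)%:Z).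
    by apply/eqP/eqP => [|->//]; apply: cycle_inj => //; exact: ltW.
  by apply/eqP/eqP => [|->//]; apply: cycle_inj => //; exact: ltW.
have fbase : exists m n, [/\ left_affine (h \o cycle k) (3 * k) m,
    right_affine (h \o cycle k) 0 n & n - m = (0 == s)%:Z - (0 == s')%:Z].
  have [d1 d2 E] := ord_cycle_V1 k0.
  have [ha _] := dir_right_slope k0 hr d1; have [hb _] := dir_left_slope k0 hr d2.
  rewrite E0 in ha; rewrite E3 in hb.
  exists (- slope h (V1 k) (opp_dir (1, 2))), (slope h (V1 k) (-2, -1)); split=> //.
  rewrite opprK -E hd /pt -E0; congr ((nat_of_bool _)%:Z - (nat_of_bool _)%:Z).
    by apply/eqP/eqP => [|->//]; apply: cycle_inj => //; lra.
  by apply/eqP/eqP => [|->//]; apply: cycle_inj => //; lra.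
have fper : (h \o cycle k) 0 = (h \o cycle k) (3 * k) by rewrite /= E0 E3.
have F (x y : R) : x <> y -> (x == y) = false by move/eqP/negbTE.
case: (ltgtP s s') => ss'; last by rewrite ss'.
  exfalso; apply: (@no_simple_pole _ (h \o cycle k) (3 * k) s s' 1
    (fun t => (t == s)%:Z - (t == s')%:Z)) => //; first by left.
  - by rewrite eqxx lt_eqF.
  - by rewrite eqxx gt_eqF.
  - by move=> t /F -> /F ->.
(* The smaller parameter is now that of the pole, hence the sign -1. *)
exfalso; apply: (@no_simple_pole _ (h \o cycle k) (3 * k) s' s (-1)
    (fun t => (t == s)%:Z - (t == s')%:Z)) => //; first by right.
- by rewrite eqxx lt_eqF.
- by rewrite eqxx gt_eqF.
- by move=> t /F -> /F ->.
Qed.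

Lemma has_divisorB k h g D D' : 0 < k -> has_divisor k h D -> has_divisor k g D' ->
  has_divisor k (fun q => h q - g q) (fun p => D p - D' p).
Proof.
move=> k0 [hr hd] [gr gd]; split; first exact: rational_functionB (ltW k0) hr gr.
by move=> p; rewrite ordB // hd gd.
Qed.

(** The point chosen by [xget] and S have the same class, so the difference of their two functions
    has as divisor the difference of the points. *)
Lemma padd_eq k P Q S : 0 < k -> Cbar k S ->
  lin_equiv k (phi k S) (fun p => phi k P p + phi k Q p) -> padd k P Q = S.
Proof.
move=> k0 CS [h hd]; rewrite /padd; case: xgetP => [M _ [CM [g gd]]|/(_ S)]; last first.
  by case; split=> //; exists h.
have [fr fd] := has_divisorB k0 gd hd.
apply: (@phi_injective k (fun q => g q - h q)) => //; split=> // p.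
by rewrite fd /phi; ring.
Qed.

End Group.

(** * Tropical lines restricted to the curve *)

Section TropicalLinesOnCurve.
Variable R : realType.
Implicit Types (p q P Q M : plane R) (h : plane R -> R) (k a b c : R).

Lemma tl_shift a b c (d : R) p : tl (a + d) (b + d) (c + d) p = tl a b c p + d.
Proof. by rewrite /tl !addr_maxl !(addrAC _ d). Qed.

Lemma continuous_tl a b c p : {for p, continuous (tl a b c : plane R -> R^o)}.
Proof.
have c1 : {for p, continuous (fun q : plane R => b + q.1 : R^o)}.
  by apply: continuousD; [exact: cst_continuous|exact: cvg_fst].
have c2 : {for p, continuous (fun q : plane R => c + q.2 : R^o)}.
  by apply: continuousD; [exact: cst_continuous|exact: cvg_snd].
have c0 : {for p, continuous (cst a : plane R -> R^o)} by exact: cst_continuous.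
exact: (continuous_max c0 (continuous_max c1 c2)).
Qed.

Lemma trop_linear_near h p : trop_linear h -> exists a b c, exists2 e : R, 0 < e &
  forall q, `|q.1 - p.1| < e -> `|q.2 - p.2| < e -> h q = tl a b c q + 0.
Proof.
move=> ht; have [a [b [c hE]]] := trop_linear_boxed (`|p.1| + `|p.2| + 1) ht.
have Bp : boxed (`|p.1| + `|p.2| + 1) p.
  by have := normr_ge0 p.1; have := normr_ge0 p.2; split; lra.
have [e e0 he] := boxed_near Bp.
by exists a, b, c, e => // q h1 h2; rewrite addr0; apply/hE/he.
Qed.

Lemma trop_linear_rational k h : 0 <= k -> trop_linear h -> rational_function k h.
Proof.
move=> k0 ht; apply: rational_function_of_slopes => //; last first.
  move=> p u _; have [a [b [c [e e0 he]]]] := trop_linear_near p ht.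
  by eexists; apply: slope_at_local e0 he _; exact: slope_at_tl.
apply: continuous_subspaceT => p; have [a [b [c [e e0 he]]]] := trop_linear_near p ht.
move=> A; rewrite he ?subrr ?normr0 // addr0 => /(@continuous_tl a b c p).
have := nbhs_box p e0.
by apply: filterS2 => q [h1 h2]; rewrite /= he // addr0.
Qed.

Lemma Cbar_V1 k : 0 < k -> Cbar k (V1 k).
Proof. by move=> k0; apply/CbarP; rewrite /triangle_eqns /V1 /=; lra. Qed.

Lemma Cbar_boxed k p : 0 < k -> Cbar k p -> boxed (k + 1) p.
Proof.
move=> k0 /CbarP; case: p => x y; rewrite /triangle_eqns /boxed /= => H.
by split; rewrite ltr_norml; apply/andP; split; lra.
Qed.

Lemma boxed_le (B B' : R) p : B <= B' -> boxed B p -> boxed B' p.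
Proof. by move=> BB [h1 h2]; split; exact: lt_le_trans BB. Qed.

Lemma trop_linear_generic h P Q (B : R) : generic_position P Q -> trop_linear h ->
  nonsmooth h P -> nonsmooth h Q ->
  exists d : R, forall p, boxed B p -> h p = line_fun P Q p + d.
Proof.
move=> gPQ ht hP hQ.
(* The box must also contain P and Q, where the ties that determine the coefficients occur. *)
pose B' := Num.max B (`|P.1| + `|P.2| + `|Q.1| + `|Q.2| + 1).
have B1 : B <= B' by rewrite le_max lexx.
have B2 : `|P.1| + `|P.2| + `|Q.1| + `|Q.2| + 1 <= B' by rewrite le_max lexx orbT.
have n1 := normr_ge0 P.1; have n2 := normr_ge0 P.2.
have n3 := normr_ge0 Q.1; have n4 := normr_ge0 Q.2.
have BP : boxed B' P by split; lra.
have BQ : boxed B' Q by split; lra.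
have [a [b [c hE]]] := trop_linear_boxed B' ht.
have loc p : boxed B' p -> nonsmooth h p <-> nonsmooth (tl a b c) p.
  move=> /boxed_near[e e0 he]; apply: (@nonsmooth_local _ _ _ _ 0 e) => // q h1 h2.
  by rewrite addr0; apply/hE/he.
move: hP hQ => /(loc _ BP)/nonsmooth_tl hP /(loc _ BQ)/nonsmooth_tl hQ.
have [eb ec] := line_coefs gPQ hP hQ.
exists (a - line_a P Q) => p Bp; rewrite hE; last exact: boxed_le Bp.
by rewrite /line_fun -tl_shift; congr (tl _ _ _ _); lra.
Qed.

Lemma nonsmooth_generic h P Q : generic_position P Q -> trop_linear h ->
  nonsmooth h P -> nonsmooth h Q -> nonsmooth h = nonsmooth (line_fun P Q).
Proof.
move=> gPQ ht hP hQ; apply/predeqP => p.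
have Bp : boxed (`|p.1| + `|p.2| + 1) p.
  by have := normr_ge0 p.1; have := normr_ge0 p.2; split; lra.
have [d hE] := trop_linear_generic (`|p.1| + `|p.2| + 1) gPQ ht hP hQ.
have [e e0 he] := boxed_near Bp.
by apply: (@nonsmooth_local _ _ _ _ d e) => // q h1 h2; apply/hE/he.
Qed.

Lemma line_through_line_fun P Q : line_through P Q (nonsmooth (line_fun P Q)).
Proof.
have [h1 h2] := line_fun_nonsmooth P Q; split=> //.
by exists (line_fun P Q) => //; exact: trop_linear_tl.
Qed.

Lemma unique_line_through P Q : generic_position P Q -> exists! r, line_through P Q r.
Proof.
move=> gPQ; exists (nonsmooth (line_fun P Q)); split; first exact: line_through_line_fun.
by move=> r [[h ht ->] hP hQ]; rewrite (nonsmooth_generic gPQ ht hP hQ).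
Qed.

(** P and Q lie on different open rays, and the vertex is reached from them along two of (1,0),
    (0,1), (-1,-1). Each of these directions lowers exactly one of x - 2y, x + y, y - 2x, a
    different one each time, and raises the other two. So each of the three is strictly larger at
    the vertex than at P or at Q, where it is at least -k. *)
Lemma line_fun_in_triangle k P Q : 0 < k -> Cbar k P -> Cbar k Q -> generic_position P Q ->
  in_triangle k (line_a P Q - line_b P Q) (line_a P Q - line_c P Q).
Proof.
have T p : 0 < k -> Cbar k p -> [/\ - k <= p.1 - 2 * p.2, - k <= p.1 + p.2 & - k <= p.2 - 2 * p.1].
  by move=> k0 /CbarP; rewrite /triangle_eqns; split; lra.
move=> k0 /(T _ k0)[P1 P2 P3] /(T _ k0)[Q1 Q2 Q3] [/lt_or_gt g1 /lt_or_gt g2 /lt_or_gt g3].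
rewrite /in_triangle /line_a /line_b /line_c.
case: g1 => g1; rewrite ?(max_l (ltW g1)) ?(max_r (ltW g1));
case: g2 => g2; rewrite ?(max_l (ltW g2)) ?(max_r (ltW g2));
(have [i|i] := leP (P.1 + Q.2) (P.2 + Q.1));
case: g3 => g3; first [exfalso; move: i g3; clear; lra | split; lra].
Qed.

Lemma nonsmooth_in_triangle k a b c p : in_triangle k (a - b) (a - c) -> Cbar k p ->
  nonsmooth (tl a b c) p <-> [\/ p = hit_left k (a - b) (a - c),
     p = hit_down k (a - b) (a - c) | p = hit_diag k (a - b) (a - c)].
Proof.
move=> it Cp; rewrite nonsmooth_tl; split.
  case=> -[e1 e2]; [apply: Or32; apply/(hit_downP it Cp)|apply: Or31; apply/(hit_leftP it Cp)|
    apply: Or33; apply/(hit_diagP it Cp)]; split; lra.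
case=> [/(hit_leftP it Cp)|/(hit_downP it Cp)|/(hit_diagP it Cp)] [e1 e2];
  [apply: Or32|apply: Or31|apply: Or33]; split; lra.
Qed.


End TropicalLinesOnCurve.

(** * Third intersection points and their divisors *)

Section Addition.
Variable R : realType.
Implicit Types (p q P Q M S : plane R) (h : plane R -> R) (k a b c : R).

Lemma hits_of_generic k a b c P Q : in_triangle k (a - b) (a - c) ->
  Cbar k P -> Cbar k Q -> generic_position P Q ->
  nonsmooth (tl a b c) P -> nonsmooth (tl a b c) Q ->
  exists M, [/\ Cbar k M,
    (forall p, Cbar k p -> nonsmooth (tl a b c) p <-> [set P; Q; M] p) &
    forall p, pt (hit_left k (a - b) (a - c)) p + pt (hit_down k (a - b) (a - c)) p
      + pt (hit_diag k (a - b) (a - c)) p = pt P p + pt Q p + pt M p].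
Proof.
move=> it CP CQ gPQ hP hQ; have [C1 C2 C3] := Cbar_hits it.
have S p (Cp : Cbar k p) := nonsmooth_in_triangle it Cp.
move: hP hQ => /(S _ CP) hP /(S _ CQ) hQ.
move: gPQ => [g1 g2 g3].
move: C1 C2 C3 hP hQ S.
move: (hit_left _ _ _) (hit_down _ _ _) (hit_diag _ _ _) => A B C C1 C2 C3 hP hQ S.
have fin M : Cbar k M ->
    (forall p, [\/ p = A, p = B | p = C] <-> [set P; Q; M] p) ->
    (forall p, pt A p + pt B p + pt C p = pt P p + pt Q p + pt M p) ->
    exists M, [/\ Cbar k M,
    (forall p, Cbar k p -> nonsmooth (tl a b c) p <-> [set P; Q; M] p) &
    forall p, pt A p + pt B p + pt C p = pt P p + pt Q p + pt M p].
  move=> CM h4 h5; exists M; split=> // p Cp.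
  by rewrite (S p Cp).
(* Generic position rules out P and Q being the same hit; in the six remaining assignments M is the
   hit left over. *)
case: hP => EP; case: hQ => EQ; subst P Q; try (by case: g1); try (by case: g2); try (by case: g3);
[apply: (fin C)|apply: (fin B)|apply: (fin C)|apply: (fin A)|apply: (fin B)|apply: (fin A)] => // p;
first [ring | by split=> [[]|[[]|]] ->;
  first [by left; left|by left; right|by right|by apply: Or31|by apply: Or32|by apply: Or33]].
Qed.

Lemma third_point_line_fun k P Q : 0 < k -> Cbar k P -> Cbar k Q -> generic_position P Q ->
  exists M, [/\ Cbar k M,
    Cbar k `&` nonsmooth (line_fun P Q) = [set P; Q; M] &
    forall p, Cbar k p -> intersection_mult k (line_fun P Q) p = pt P p + pt Q p + pt M p].
Proof.
move=> k0 CP CQ gPQ; have it := line_fun_in_triangle k0 CP CQ gPQ.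
have [hP hQ] := line_fun_nonsmooth P Q.
have [M [CM MS MD]] := hits_of_generic it CP CQ gPQ hP hQ.
exists M; split=> //.
  apply/seteqP; split=> [p [Cp]|p h]; first by move/(MS p Cp).
  have Cp : Cbar k p by case: h => [[]|] ->.
  by split=> //; apply/(MS p Cp).
by move=> p Cp; rewrite mult_tl_in_triangle.
Qed.

Lemma mult_ord_generic k P Q p : 0 < k -> Cbar k P -> Cbar k Q -> generic_position P Q ->
  Cbar k p ->
  intersection_mult k (line_fun P Q) p = ord k (line_fun P Q) p + 3 * pt (V1 k) p.
Proof.
move=> k0 CP CQ gPQ Cp; have [i1 i2 i3] := line_fun_in_triangle k0 CP CQ gPQ.
by apply: mult_tl_ord => //; lra.
Qed.

Lemma weighted_order_generic k (C : set (plane R)) dirs h P Q p : 0 < k -> generic_position P Q ->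
  trop_linear h -> nonsmooth h P -> nonsmooth h Q -> Cbar k p ->
  weighted_order C dirs h p = weighted_order C dirs (line_fun P Q) p.
Proof.
move=> k0 gPQ ht hP hQ Cp.
have [d hE] := trop_linear_generic (k + 1) gPQ ht hP hQ.
have [e e0 he] := boxed_near (Cbar_boxed k0 Cp).
by apply: (@weighted_order_local _ _ _ _ _ _ d e) => // q h1 h2; apply/hE/he.
Qed.

Lemma has_divisor_of_ord k h P Q M : 0 < k -> trop_linear h ->
  Cbar k P -> Cbar k Q -> Cbar k M ->
  (forall p, Cbar k p -> ord k h p + 3 * pt (V1 k) p = pt P p + pt Q p + pt M p) ->
  has_divisor k h (fun p => pt P p + pt Q p + pt M p - 3 * pt (V1 k) p).
Proof.
move=> k0 ht CP CQ CM hE; split; first exact: trop_linear_rational (ltW k0) ht.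
move=> p; case: (pselect (Cbar k p)) => Cp; first by rewrite -hE // addrK.
rewrite ord_out // !pt_neq ?mulr0 ?subr0 //; move=> E; apply: Cp; rewrite E //.
exact: Cbar_V1.
Qed.

Lemma padd_of_divisor k h P Q : 0 < k ->
  has_divisor k h (fun p => pt (V1 k) p + pt P p + pt Q p - 3 * pt (V1 k) p) ->
  padd k P Q = V1 k.
Proof.
move=> k0 hd; apply: padd_eq => //; first exact: Cbar_V1.
(* The divisor wanted is -(h), obtained from differences alone as that of (h - h) - h. *)
have [fr fd] := has_divisorB k0 (has_divisorB k0 hd hd) hd.
by eexists; split; [exact: fr|move=> p; rewrite fd /phi; ring].
Qed.

(** The tie at V1 alone implies the three conditions of [mult_tl_ord], so this covers every tropical
    line through V1, in generic position or not. *)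
Lemma divisor_of_third_point k h P M : 0 < k -> trop_linear h -> nonsmooth h (V1 k) ->
  Cbar k P -> Cbar k M ->
  (forall p, Cbar k p -> intersection_mult k h p = pt (V1 k) p + pt P p + pt M p) ->
  has_divisor k h (fun p => pt (V1 k) p + pt P p + pt M p - 3 * pt (V1 k) p).
Proof.
move=> k0 ht hV CP CM hE; apply: has_divisor_of_ord => //; first exact: Cbar_V1.
move=> p Cp; rewrite -hE //.
have [a [b [c abc]]] := trop_linear_boxed (k + 1) ht.
have loc q : Cbar k q -> exists2 e : R, 0 < e & forall x : plane R, `|x.1 - q.1| < e ->
   `|x.2 - q.2| < e -> h x = tl a b c x + 0.
  move=> Cq; have [e e0 he] := boxed_near (Cbar_boxed k0 Cq).
  by exists e => // x h1 h2; rewrite addr0; apply/abc/he.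
have [e e0 he] := loc _ (Cbar_V1 k0).
have /nonsmooth_tl := (nonsmooth_local e0 he).1 hV.
have [e' e0' he'] := loc p Cp.
rewrite /ord /intersection_mult !(weighted_order_local _ _ e0' he') => H.
apply/esym; apply: mult_tl_ord => //; case: H; rewrite /V1 /= => -[H1 H2]; lra.
Qed.

Definition swap P : plane R := (P.2, P.1).

Lemma Cbar_swap k P : Cbar k P -> Cbar k (swap P).
Proof. by move=> /CbarP H; apply/CbarP; move: H; rewrite /triangle_eqns /=; lra. Qed.

End Addition.

(** * The line through V1 and the reflected point *)

Section SecondLine.
Variable R : realType.
Implicit Types (p q P Q M S : plane R) (h : plane R -> R) (k a b c : R).

Definition reflect_fun P : plane R -> R := tl (Num.max P.1 P.2) 0 0.

(** Extreme case P = V1 of the reflecting line: its vertex is V1, where only the unbounded edge has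
    nonzero slope, namely 1 with weight 3. *)
Lemma mult_vertex_V1 k p : 0 < k -> Cbar k p ->
  intersection_mult k (tl k 0 0) p = 3 * pt (V1 k) p /\
  (nonsmooth (tl k 0 0) p <-> p = V1 k).
Proof.
move=> k0 Cp; rewrite nonsmooth_tl /twice3.
have [->|Np] := pselect (p = V1 k).
  rewrite mult_V1 // pt_refl !slope_tl /slope3 /lexmax /V1 /= !add0r ?ltxx /= ?ltxx /= ?ltxx /=.
  by split=> //; split=> // _; apply: Or31; split=> //; rewrite add0r.
have [p1 p2] : 0 + p.1 < k /\ 0 + p.2 < k.
  move: Np; case: p Cp => x y /CbarP; rewrite /triangle_eqns /V1 /= => H Np.
  have [xk|xk] := ltP x k; first by split; lra.
  by exfalso; apply: Np; congr pair; lra.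
split; last by split=> [[] [e1 e2]|/Np//]; exfalso; lra.
rewrite pt_neq // mulr0.
have S u : slope (tl k 0 0) p u = 0.
  rewrite slope_tl /slope3 /lexmax /=.
  by case: (ltgtP (0 + p.1) (0 + p.2)) => i /=; rewrite ?p1 ?p2 ltNge ltW ?p1 ?p2.
have [ep|ep|ep|e e1 e2|e e1 e2|e e1 e2] := Cbar_cases Cp.
- by case: Np.
- by rewrite ep mult_V2 // -ep !S.
- by rewrite ep mult_V3 // -ep !S.
- by rewrite mult_E12 // !S.
- by rewrite mult_E23 // !S.
- by rewrite mult_E31 // !S.
Qed.

(** Other extreme case: the vertex is the midpoint of V2V3, fixed by [swap], where h has outgoing
    slope 1 both ways along the edge; hence the multiplicity 2. *)
Lemma mult_vertex_midpoint k p : 0 < k -> Cbar k p ->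
  intersection_mult k (tl (- k / 2) 0 0) p = pt (V1 k) p + 2 * pt (- k / 2, - k / 2) p /\
  (nonsmooth (tl (- k / 2) 0 0) p <-> p = V1 k \/ p = (- k / 2, - k / 2)).
Proof.
move=> k0 Cp; split; last first.
  rewrite nonsmooth_tl /twice3; move: Cp => /CbarP; rewrite /triangle_eqns /V1; case: p => x y /= H.
  split.
    by case=> -[e1 e2]; [right|right|have [i|i] := ltP 0 y; [left|right]]; congr pair; lra.
  by case=> -[-> ->]; apply: Or33; split; lra.
have Nmid x y : x <> y -> pt (- k / 2, - k / 2) (x, y) = 0.
  by move=> xy; apply: pt_neq => -[E1 E2]; apply: xy; rewrite E1 E2.
have [ep|ep|ep|e e1 e2|e e1 e2|e e1 e2] := Cbar_cases Cp; clear Cp.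
- rewrite {}ep mult_V1 // pt_refl pt_neq; last by case=> ?; lra.
  rewrite !slope_tl /slope3 /lexmax /V1 /= !ltxx /=.
  by have -> : (- k / 2 < 0 + k) = true by lra.
- rewrite {}ep mult_V2 // pt_neq; last by case=> ?; lra.
  rewrite Nmid; last by lra.
  rewrite !slope_tl /slope3 /lexmax /V2 /=.
  have -> : (0 - k < 0 + 0) = true by lra.
  by have /= -> : (- k / 2 < 0 + 0) = true by lra.
- rewrite {}ep mult_V3 // pt_neq; last by case=> ?; lra.
  rewrite Nmid; last by lra.
  rewrite !slope_tl /slope3 /lexmax /V3 /=.
  have -> : (0 + 0 < 0 - k) = false by lra.
  have -> : (0 - k < 0 + 0) = true by lra.
  by have /= -> : (- k / 2 < 0 + 0) = true by lra.
- rewrite mult_E12 // pt_neq; last by move=> E; rewrite E /= in e2; lra.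
  rewrite pt_neq; last by move=> E; rewrite E /= in e1; lra.
  rewrite !slope_tl /slope3 /lexmax /=.
  have -> : (0 + p.1 < 0 + p.2) = true by lra.
  by have /= -> : (- k / 2 < 0 + p.2) = true by lra.
- rewrite mult_E23 // pt_neq; last by move=> E; rewrite E /= in e2; lra.
  rewrite !slope_tl /slope3 /lexmax /=.
  have [i|i|i] := ltgtP (0 + p.1) (0 + p.2) => /=.
  + have -> : (- k / 2 < 0 + p.2) = true by lra.
    by rewrite pt_neq // => E; rewrite E /= in i; lra.
  + have -> : (- k / 2 < 0 + p.1) = true by lra.
    by rewrite pt_neq // => E; rewrite E /= in i; lra.
  + have E : p = (- k / 2, - k / 2) by case: p e i {e1 e2} => x y /= e i; congr pair; lra.
    have -> : (- k / 2 < 0 + p.1) = false by rewrite E /=; lra.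
    have -> : (0 + p.1 < - k / 2) = false by rewrite E /=; lra.
    by rewrite E pt_refl.
- rewrite mult_E31 // pt_neq; last by move=> E; rewrite E /= in e2; lra.
  rewrite pt_neq; last by move=> E; rewrite E /= in e1; lra.
  rewrite !slope_tl /slope3 /lexmax /=.
  have -> : (0 + p.1 < 0 + p.2) = false by lra.
  have -> : (0 + p.2 < 0 + p.1) = true by lra.
  by have /= -> : (- k / 2 < 0 + p.1) = true by lra.
Qed.

Lemma third_point_reflect k P : 0 < k -> Cbar k P ->
  (forall p, Cbar k p -> intersection_mult k (reflect_fun P) p =
     pt (V1 k) p + pt P p + pt (swap P) p) /\
  (forall p, Cbar k p -> nonsmooth (reflect_fun P) p <-> [set V1 k; P; swap P] p).
Proof.
move=> k0 CP; rewrite /reflect_fun; set m := Num.max P.1 P.2.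
have [mk mk'] : m <= k /\ - k / 2 <= m.
  move: CP => /CbarP; rewrite /m /triangle_eqns; case: (leP P.1 P.2) => i H; lra.
case: (ltgtP m k) mk => // [mk|mE] _; last first.
  have -> : P = V1 k.
    move: CP mE => /CbarP; rewrite /m /triangle_eqns /V1; case: P {m mk'} => x y /=.
    by case: (leP x y) => i H E; congr pair; lra.
  rewrite mE; split=> p Cp; have [h1 h2] := mult_vertex_V1 k0 Cp.
    by rewrite h1 /swap /=; ring.
  by rewrite h2; split=> [->|[[|]|]]; [right|..].
case: (ltgtP (- k / 2) m) mk' => // [mk'|mE] _; last first.
  have EP : P = (- k / 2, - k / 2).
    move: CP mE => /CbarP; rewrite /m /triangle_eqns; case: P {m mk} => x y /=.
    by case: (leP x y) => i H E; congr pair; lra.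
  rewrite -mE; split=> p Cp; have [h1 h2] := mult_vertex_midpoint k0 Cp.
    by rewrite h1 EP /swap /=; ring.
  by rewrite h2 EP; split=> [[]->|[[|]|]]; [left; left|right|left|right|right].
(* With both extremes removed, - k / 2 < m < k says exactly that (m, m) is inside the triangle. *)
have it : in_triangle k (m - 0) (m - 0) by split; lra.
have dE : V1 k = hit_diag k (m - 0) (m - 0).
  by apply/(hit_diagP it (Cbar_V1 k0)); rewrite /V1 /=; split; lra.
have CS := Cbar_swap CP.
have [[lE rE]|[lE rE]] : (P = hit_left k (m - 0) (m - 0) /\ swap P = hit_down k (m - 0) (m - 0)) \/
    (swap P = hit_left k (m - 0) (m - 0) /\ P = hit_down k (m - 0) (m - 0)).
  case: (leP P.1 P.2) @m mk mk' it dE => i m mk mk' it dE; [left|right].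
    by split; [apply/(hit_leftP it CP)|apply/(hit_downP it CS)]; rewrite /m /=; split; lra.
  by split; [apply/(hit_leftP it CS)|apply/(hit_downP it CP)]; rewrite /m /=; split; lra.
- split=> p Cp; first by rewrite mult_tl_in_triangle // -dE -lE -rE; ring.
  rewrite (nonsmooth_in_triangle it Cp) -dE -lE -rE.
  by split=> [[]->|[[]|] ->]; [left; right|right|left; left|apply: Or33|apply: Or31|apply: Or32].
- split=> p Cp; first by rewrite mult_tl_in_triangle // -dE -lE -rE; ring.
  rewrite (nonsmooth_in_triangle it Cp) -dE -lE -rE.
  by split=> [[]->|[[]|] ->]; [right|left; right|left; left|apply: Or33|apply: Or32|apply: Or31].
Qed.

Lemma exists_second_line k P : 0 < k -> Cbar k P ->
  line_through (V1 k) P (nonsmooth (reflect_fun P)) /\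
  third_point k (nonsmooth (reflect_fun P)) (V1 k) P (swap P).
Proof.
move=> k0 CP; have [hm hS] := third_point_reflect k0 CP.
have CV := Cbar_V1 k0; have CS := Cbar_swap CP.
split.
  split; [|by apply/(hS _ CV); left; left|by apply/(hS _ CP); left; right].
  by exists (reflect_fun P) => //; exact: trop_linear_tl.
exists (reflect_fun P); split=> //; first exact: trop_linear_tl.
apply/seteqP; split=> [p [Cp]|p H]; first by move/(hS p Cp).
have Cp : Cbar k p by case: H => [[]|] ->.
by split=> //; apply/(hS p Cp).
Qed.

End SecondLine.

Unset Implicit Arguments.

Theorem mainTheorem1 (R : realType) (k : R) (hk : 0 < k)
    (P Q : plane R) (hP : Cbar k P) (hQ : Cbar k Q)
    (hPQ : generic_position P Q) :
  (exists! r1 : set (plane R), line_through P Q r1) /\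
  forall r1 : set (plane R), line_through P Q r1 ->
    (exists! Mbar : plane R, third_point k r1 P Q Mbar) /\
    forall Mbar : plane R, third_point k r1 P Q Mbar ->
      [/\ (* P, Q, Mbar are the zeros of h in R(3 V1), i.e. of (h) + 3 V1 *)
          forall h : plane R -> R, trop_linear h -> nonsmooth h = r1 ->
            [set p | 0 < ord k h p + 3 * pt (V1 k) p] = [set P; Q; Mbar] /\
            has_divisor k h
              (fun p => pt P p + pt Q p + pt Mbar p - 3 * pt (V1 k) p),
          padd k (padd k P Q) Mbar = V1 k,
          (generic_position (V1 k) Mbar ->
             exists! r2 : set (plane R), line_through (V1 k) Mbar r2),
          (exists (r2 : set (plane R)) (M : plane R),
             line_through (V1 k) Mbar r2 /\ third_point k r2 (V1 k) Mbar M) &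
          forall (r2 : set (plane R)) (M : plane R),
            line_through (V1 k) Mbar r2 -> third_point k r2 (V1 k) Mbar M ->
            padd k Mbar M = V1 k /\ padd k P Q = M].
Proof.
split; first exact: unique_line_through.
move=> r1 [[h1 th1 ->] h1P h1Q].
rewrite (nonsmooth_generic hPQ th1 h1P h1Q) => {h1 th1 h1P h1Q}.
have [M0 [CM0 setM0 multM0]] := third_point_line_fun hk hP hQ hPQ.
have [lP lQ] := line_fun_nonsmooth P Q.
(* Evaluated at M0, both multiplicity formulas share the terms of P and Q; what remains is
   [pt M M0 = 1]. *)
have uniqM M : third_point k (nonsmooth (line_fun P Q)) P Q M -> M = M0.
  move=> [h [th rE _ hm]].
  have := hm M0 CM0; rewrite /intersection_mult (weighted_order_generic _ _ hk hPQ th) // -?rE //.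
  rewrite -/(intersection_mult _ _ _) multM0 // pt_refl /pt => /addrI.
  by case: eqP.
split.
  exists M0; split; last by move=> M /uniqM.
  by exists (line_fun P Q); split=> //; exact: trop_linear_tl.
move=> M /uniqM -> {M}.
have hdiv h : trop_linear h -> nonsmooth h = nonsmooth (line_fun P Q) ->
    forall p, Cbar k p -> ord k h p + 3 * pt (V1 k) p = pt P p + pt Q p + pt M0 p.
  move=> th hE p Cp; rewrite -multM0 // mult_ord_generic // /ord.
  by rewrite (weighted_order_generic _ _ hk hPQ th) // hE.
have divPQ := has_divisor_of_ord hk (trop_linear_tl _ _ _) hP hQ CM0
  (hdiv _ (trop_linear_tl _ _ _) erefl).
have second M h : trop_linear h -> nonsmooth h (V1 k) -> Cbar k M ->
   (forall p, Cbar k p -> intersection_mult k h p = pt (V1 k) p + pt M0 p + pt M p) ->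
   [/\ padd k M0 M = V1 k, padd k M M0 = V1 k & padd k P Q = M].
  move=> th hV CM hm; have hd := divisor_of_third_point hk th hV CM0 CM hm.
  split; first exact: padd_of_divisor hd.
    apply: (@padd_of_divisor _ k h) => //; case: hd => hr hd; split=> // p.
    by rewrite hd; ring.
  (* The function h minus [line_fun P Q] has divisor M + V1 - P - Q. *)
  apply: padd_eq => //; have [fr fd] := has_divisorB hk hd divPQ.
  by eexists; split; [exact: fr|move=> p; rewrite fd /phi; ring].
have [r2V r2M] := exists_second_line hk CM0.
split.
- move=> h th hE; split; last by apply: has_divisor_of_ord => //; exact: hdiv.
  apply/seteqP; split=> [p /= H|p H] /=.
    case: (pselect (Cbar k p)) => Cp.
      move: H; rewrite hdiv // /pt.
      case: (eqVneq p P) => [->|]; first by left; left.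
      case: (eqVneq p Q) => [->|]; first by left; right.
      by case: (eqVneq p M0) => [->|]; first by right.
    by move: H; rewrite ord_out // pt_neq // => E; apply: Cp; rewrite E; exact: Cbar_V1.
  have Cp : Cbar k p by case: H => [[]|] ->.
  rewrite hdiv //; have pt0 X : 0 <= pt X p by rewrite /pt; case: (p == X).
  have p1 := pt0 P; have p2 := pt0 Q; have p3 := pt0 M0.
  by case: H => [[]|] E; have := pt_refl p; rewrite {1}E; lia.
- have [h [th _ hset hm]] := r2M.
  have CS := Cbar_swap CM0.
  have hV : nonsmooth (reflect_fun M0) (V1 k) by case: r2V.
  have [hm' _] := third_point_reflect hk CM0.
  (* The line to the reflected point identifies P + Q as [swap M0], whose sum with M0 is V1. *)
  have [_ e1 ->] := second _ _ (trop_linear_tl _ _ _) hV CS hm'.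
  exact: e1.
- exact: unique_line_through.
- by exists (nonsmooth (reflect_fun M0)), (swap M0).
- move=> r2 M [_ rV rM] [h [th rE hset hm]].
  have CM : Cbar k M.
    have : [set V1 k; M0; M] M by right.
    by rewrite -hset => -[].
  by have [] := second M h th; rewrite -?rE.
Qed.
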